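(* Let $\alpha\in(1,2]$ and $b\in\mathbb{R}$, and consider the probability measures $$d\tau_\alpha(x)=\exp\big(-|x|^\alpha-|x|^{\alpha-1}\cos(x)\big)\frac{dx}{Z_\alpha},\qquad d\gamma_{\alpha,b}(x)=(1+x)^be^{-x^\alpha}\mathbf 1_{x\ge0}\frac{dx}{Z_{\alpha,b}}$$ on $\mathbb{R}$, where $Z_\alpha$, $Z_{\alpha,b}$ are the normalizing constants. There exists $a>0$ such that $\tau_\alpha$ and $\gamma_{\alpha,b}$ satisfy a logarithmic Sobolev inequality of function $H_{a,\alpha}$, i.e. each satisfies $LSI_{a,\alpha}(C)$ for some $C<\infty$.
   Context: For $\alpha\in(1,2]$ let $\beta\ge2$ satisfy $1/\alpha+1/\beta=1$, and for $a>0$, $x\in\mathbb{R}$, let $H_{a,\alpha}(x)=\frac{x^2}{2}$ if $|x|\le a$ and $H_{a,\alpha}(x)=a^{2-\beta}\frac{|x|^\beta}{\beta}+a^2\frac{\beta-2}{2\beta}$ if $|x|\ge a$. A probability measure $\mu$ on $\mathbb{R}$ satisfies $LSI_{a,\alpha}(C)$ if for every $C^\infty$ and $L^2$ function $f$ on $\mathbb{R}$, $$\mathbf{Ent}_\mu(f^2)\le C\int H_{a,\alpha}\Big(\frac{f'}{f}\Big)f^2d\mu,\qquad \mathbf{Ent}_\mu(f^2)=\int f^2\log\frac{f^2}{\int f^2d\mu}d\mu,$$ with the convention $0/0=\infty$. *)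

(* Defs.v *)
From HB Require Import structures.
From mathcomp Require Import all_boot all_order all_algebra.
From mathcomp Require Import all_classical all_reals all_analysis.
From mathcomp Require Import measurable_realfun lra.

Set Implicit Arguments.
Unset Strict Implicit.
Unset Printing Implicit Defensive.

Import Order.TTheory GRing.Theory Num.Theory.
Import numFieldNormedType.Exports.

Local Open Scope classical_set_scope.
Local Open Scope ring_scope.

Section log_sobolev.
Context {R : realType}.
Implicit Types (a beta C : R) (f g : R -> R).

(* beta stands for the conjugate exponent of alpha; powR is only applied to
   nonnegative bases. *)
Definition Hfun a beta (x : R) : R :=
  if `|x| <= a then x ^+ 2 / 2
  else a `^ (2 - beta) * (`|x| `^ beta / beta)
       + a ^+ 2 * ((beta - 2) / (2 * beta)).

Definition Hfun_ext a beta (x : \bar R) : \bar R :=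
  if x is r%:E then (Hfun a beta r)%:E else +oo%E.

(* The quotient with value +oo for a zero denominator, 0 / 0 included.  The
   sign at u / 0 with u != 0 is irrelevant since Hfun_ext is even. *)
Definition quot_ext (u v : R) : \bar R :=
  if v == 0 then +oo%E else (u / v)%:E.

Definition smooth f := forall (n : nat) (x : R), derivable (derive1n n f) x 1.

Variable mu : probability (measurableTypeR R) R.

Local Open Scope ereal_scope.

(* Used for g >= 0 with finite integral; since ln 0 = 0 and x / 0 = 0 in R,
   the integrand is 0 where g vanishes.  The value +oo is possible. *)
Definition entropy g : \bar R :=
  \int[mu]_x (g x * ln (g x / fine (\int[mu]_y (g y)%:E)))%:E.

(* Where f vanishes, the integrand on the right is +oo * 0, which is 0 in
   \bar R: zeros of f do not make the right-hand side infinite. *)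
Definition LSI a beta C : Prop :=
  forall f : R -> R, smooth f -> f \in Lfun mu 2%:E ->
    entropy (fun x => (f x ^+ 2)%R) <=
    C%:E * \int[mu]_x (Hfun_ext a beta (quot_ext (derive1 f x) (f x))
                       * ((f x ^+ 2)%R)%:E).

End log_sobolev.

Section normalization.
Context {R : realType}.
Local Notation leb := (@lebesgue_measure R).

Definition total_mass (w : R -> R) : \bar R := (\int[leb]_x (w x)%:E)%E.

Record normalizable (w : R -> R) : Prop := Normalizable {
  normalizable_meas : measurable_fun [set: R] w ;
  normalizable_ge0 : forall x, 0 <= w x ;
  normalizable_gt0 : (0 < total_mass w)%E ;
  normalizable_lty : (total_mass w < +oo)%E }.

(* The proof argument lets the probability structure be inferred. *)
Definition normalized (w : R -> R) (_ : normalizable w)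
    (A : set (measurableTypeR R)) : \bar R :=
  (\int[leb]_(x in A) (w x / fine (total_mass w))%:E)%E.

Section instance.
Variables (w : R -> R) (nw : normalizable w).

Let Z := fine (total_mass w).

Let Z_gt0 : 0 < Z.
Proof.
by apply: fine_gt0; rewrite (normalizable_gt0 nw) (normalizable_lty nw).
Qed.

Let pdf_ge0 x : 0 <= w x / Z.
Proof. by rewrite divr_ge0 ?(normalizable_ge0 nw)// ltW. Qed.

Let measurable_pdf : measurable_fun [set: R] (EFin \o (fun x => w x / Z)).
Proof.
apply/measurable_EFinP; apply: measurable_funM => //.
exact: normalizable_meas nw.
Qed.

Let normalized0 : normalized nw set0 = 0%E.
Proof. by rewrite /normalized integral_set0. Qed.

Let normalized_ge0 A : (0 <= normalized nw A)%E.
Proof.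
by apply: integral_ge0 => x _; rewrite lee_fin; exact: pdf_ge0.
Qed.

Let normalized_sigma_additive : semi_sigma_additive (normalized nw).
Proof.
move=> /= F mF tF mUF; rewrite /normalized; apply: cvg_toP.
  apply: ereal_nondecreasing_is_cvgn => m n mn.
  apply: lee_sum_nneg_natr => // k _ _; apply: integral_ge0 => /= x Fkx.
  by rewrite lee_fin; exact: pdf_ge0.
rewrite ge0_integral_bigcup//=.
- exact: measurable_funTS.
- by move=> x _; rewrite lee_fin; exact: pdf_ge0.
Qed.

HB.instance Definition _ := isMeasure.Build _ _ _ (normalized nw)
  normalized0 normalized_ge0 normalized_sigma_additive.

Let normalized_setT : normalized nw [set: _] = 1%E.
Proof.
rewrite /normalized; under eq_integral do rewrite mulrC EFinM.
rewrite ge0_integralZl//=; first last.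
- by rewrite lee_fin invr_ge0 ltW.
- by move=> x _; rewrite lee_fin; exact: normalizable_ge0 nw x.
- by apply/measurable_EFinP; exact: normalizable_meas nw.
rewrite -/(total_mass w) -[X in (_ * X)%E]fineK; last first.
  by rewrite ge0_fin_numE ?(normalizable_lty nw)// ltW// (normalizable_gt0 nw).
by rewrite -EFinM mulVf// gt_eqF.
Qed.

HB.instance Definition _ :=
  @Measure_isProbability.Build _ _ R (normalized nw) normalized_setT.

End instance.

Let integral_expRNnorm : (\int[leb]_x (expR (- `|x|))%:E < +oo)%E.
Proof.
rewrite ge0_symfun_integralT//=; last 2 first.
- move=> x; apply: continuous_comp; last exact: continuous_expR.
  by apply: (@continuousN _ R^o); exact: norm_continuous.
- by move=> x /=; rewrite normrN.
rewrite lte_mul_pinfty//.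
rewrite (@eq_integral _ _ _ leb _ (fun x => (exponential_pdf 1 x)%:E)); last first.
  move=> x; rewrite inE/= => x0.
  by rewrite exponential_pdfE// mul1r mulN1r ger0_norm.
apply: (@le_lt_trans _ _ 1%E); last by rewrite ltry.
rewrite -(integral_exponential_pdf (@ltr01 R)).
apply: ge0_subset_integral => //.
- by rewrite -set_itvcy; exact: measurable_itv.
- by apply/measurable_EFinP; exact: measurable_exponential_pdf.
- by move=> x _; rewrite lee_fin; exact: exponential_pdf_ge0.
Qed.

Lemma exp_dominated_normalizable (w : R -> R) (c K : R) :
  measurable_fun [set: R] w -> (forall x, 0 <= w x) ->
  0 < c -> (forall x, 0 <= x <= 1 -> c <= w x) ->
  (forall x, w x <= expR (K - `|x|)) -> normalizable w.
Proof.
move=> mw w0 c0 cw wK.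
have mwE : measurable_fun [set: R] (EFin \o w) by exact/measurable_EFinP.
have mexp : measurable_fun [set: R] (EFin \o (fun x : R => expR (- `|x|))).
  apply/measurable_EFinP; apply: measurableT_comp => //.
  exact: measurableT_comp.
split => //.
- apply: (@lt_le_trans _ _ c%:E); first by rewrite lte_fin.
  apply: (@le_trans _ _ (\int[leb]_(x in `[0%R, 1%R]) (w x)%:E)%E); last first.
    by apply: ge0_subset_integral => // x _; rewrite lee_fin.
  apply: (@le_trans _ _ (\int[leb]_(x in `[0%R, 1%R]) c%:E)%E).
    rewrite integral_cst//=.
    by rewrite lebesgue_measure_itv/= lte_fin ltr01 sube0 mule1.
  apply: ge0_le_integral => //.
  + by move=> x _; rewrite lee_fin ltW.
  + exact: measurable_funTS.
- apply: (@le_lt_trans _ _ (\int[leb]_x ((expR K)%:E * (expR (- `|x|))%:E))%E).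
    apply: ge0_le_integral => //.
    + by move=> x _; rewrite lee_fin.
    + exact: measurable_funeM.
    + by move=> x _; rewrite -EFinM lee_fin -expRD; exact: wK.
  rewrite ge0_integralZl//=.
  by rewrite lte_mul_pinfty// lee_fin expR_ge0.
Qed.

(* x ^ alpha dominates every linear function. *)
Lemma powR_superlinear (alpha c : R) : 1 < alpha -> 0 <= c ->
  exists K, forall x, 0 <= x -> c * x - x `^ alpha <= K - x.
Proof.
move=> a1 c0.
have e0 : 0 < alpha - 1 by lra.
pose M := (c + 1) `^ (alpha - 1)^-1.
exists ((c + 1) * M) => x x0.
rewrite -(@mulr_powRB1 _ x alpha)//; last lra.
have M0 : 0 <= M by exact: powR_ge0.
have [xM|Mx] := leP x M.
  have := mulr_ge0 x0 (powR_ge0 x (alpha - 1)).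
  have : (c + 1) * x <= (c + 1) * M by rewrite ler_wpM2l//; lra.
  by rewrite mulrDl mul1r; lra.
have MxE : c + 1 <= x `^ (alpha - 1).
  rewrite (_ : c + 1 = M `^ (alpha - 1)); last first.
    by rewrite -powRrM mulVf ?gt_eqF// powRr1//; lra.
  by apply: ge0_ler_powR; rewrite ?nnegrE// ltW.
have : x * (c + 1) <= x * x `^ (alpha - 1) by rewrite ler_wpM2l.
have : 0 <= (c + 1) * M by rewrite mulr_ge0//; lra.
by rewrite mulrDr mulr1 (mulrC x c); lra.
Qed.

End normalization.

Section measures.
Context {R : realType}.
Variables (alpha b : R).

Definition tau_weight (x : R) : R :=
  expR (- `|x| `^ alpha - `|x| `^ (alpha - 1) * cos x).

Definition gamma_weight (x : R) : R :=
  (1 + x) `^ b * expR (- x `^ alpha) * \1_`[0, +oo[ x.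

Lemma tau_normalizable : 1 < alpha <= 2 -> normalizable tau_weight.
Proof.
move=> /andP[a1 a2].
have [K HK] := powR_superlinear a1 (@ler01 R).
have p0 (x : R) : 0 <= `|x| `^ (alpha - 1) by exact: powR_ge0.
apply: (@exp_dominated_normalizable _ _ (expR (- 2)) (K + 1)).
- apply: measurableT_comp => //; apply: measurable_funB.
    apply: measurableT_comp => //.
    apply: (measurableT_comp (measurable_powR _)); exact: normr_measurable.
  apply: measurable_funM; last first.
    by apply: continuous_measurable_fun; exact: continuous_cos.
  apply: (measurableT_comp (measurable_powR _)); exact: normr_measurable.
- by move=> x; exact: expR_ge0.
- exact: expR_gt0.
- move=> x /andP[x0 x1]; rewrite ler_expR ger0_norm//.
  have le1 r : 0 <= r -> x `^ r <= 1.
    by move=> r0; rewrite -[leRHS](congr1 (fun f => f r) (@powR1 R));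
      apply: ge0_ler_powR; rewrite ?nnegrE.
  have h1 : x `^ alpha <= 1 by apply: le1; lra.
  have h2 : x `^ (alpha - 1) <= 1 by apply: le1; lra.
  have h3 : x `^ (alpha - 1) * cos x <= x `^ (alpha - 1).
    by rewrite ler_piMr ?powR_ge0// cos_le1.
  lra.
- move=> x; rewrite ler_expR.
  have h1 : - `|x| `^ (alpha - 1) <= `|x| `^ (alpha - 1) * cos x.
    by rewrite -[leLHS]mulrN1 ler_wpM2l// cos_geN1.
  have h2 : `|x| `^ (alpha - 1) <= 1 + `|x|.
    have x1 : 1 <= 1 + `|x| by have := normr_ge0 x; lra.
    apply: (@le_trans _ _ ((1 + `|x|) `^ (alpha - 1))).
      by apply: ge0_ler_powR; rewrite ?nnegrE//; have := normr_ge0 x; lra.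
    by apply: ler1_powR => //; lra.
  by have := HK _ (normr_ge0 x); lra.
Qed.

Lemma gamma_normalizable : 1 < alpha <= 2 -> normalizable gamma_weight.
Proof.
move=> /andP[a1 a2].
have [K HK] := powR_superlinear a1 (normr_ge0 b).
have wE x : 0 <= x -> gamma_weight x = expR (b * ln (1 + x) - x `^ alpha).
  move=> x0; rewrite /gamma_weight indicE mem_set/= ?in_itv/= ?x0// mulr1.
  by rewrite expRD /powR gt_eqF//; lra.
have ln01 (x : R) : 0 <= x -> 0 <= ln (1 + x) <= x.
  by move=> x0; rewrite ln_ge0 ?le_ln1Dx//; lra.
have blnE x : 0 <= x -> - (`|b| * x) <= b * ln (1 + x) <= `|b| * x.
  move=> x0; have /andP[l0 lx] := ln01 x x0.
  rewrite -ler_norml normrM (ger0_norm l0).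
  by rewrite ler_wpM2l.
apply: (@exp_dominated_normalizable _ _ (expR (- `|b| - 1)) K).
- apply: measurable_funM; last exact: measurable_indic.
  apply: measurable_funM.
    apply: (measurableT_comp (measurable_powR _)); exact: measurable_funD.
  apply: measurableT_comp => //; apply: measurableT_comp => //.
- by move=> x; rewrite !mulr_ge0 ?powR_ge0 ?expR_ge0.
- exact: expR_gt0.
- move=> x /andP[x0 x1]; rewrite wE// ler_expR.
  have h1 : x `^ alpha <= 1.
    rewrite -[leRHS](congr1 (fun f => f alpha) (@powR1 R)).
    by apply: ge0_ler_powR; rewrite ?nnegrE//; lra.
  have /andP[h2 _] := blnE x x0.
  have h3 : `|b| * x <= `|b| by rewrite ler_piMr.
  lra.
- move=> x; have [x0|x0] := leP 0 x.
    rewrite wE// ler_expR ger0_norm//.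
    by have /andP[_ h] := blnE x x0; have := HK _ x0; lra.
  rewrite /gamma_weight indicE memNset/= ?mulr0 ?expR_ge0//.
  by rewrite in_itv/= andbT; apply/negP; rewrite -ltNge.
Qed.

Hypothesis alpha12 : 1 < alpha <= 2.

Definition tau : probability (measurableTypeR R) R :=
  normalized (tau_normalizable alpha12).

Definition gamma : probability (measurableTypeR R) R :=
  normalized (gamma_normalizable alpha12).

End measures.

(* Main.v *)
Require Import Defs.
From mathcomp Require Import all_boot all_order all_algebra.
From mathcomp Require Import all_classical all_reals all_analysis.
From mathcomp Require Import ring lra measurable_realfun.

(* Work on each half-line with the weight rho = exp(-V), where
   V'(x) >= c x^(alpha-1) - M.
   For tau the potential is first replaced by one at bounded distance that is
   differentiable up to 0, so that the weights are merely comparable.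

   Integrating the derivative of a well chosen function over [0, n] (a Lyapunov
   argument) bounds weighted integrals:
   - (F - F(0))^2 (eta + exp(- l x)) rho, with F = sqrt(1 + f^2), gives a
     Poincare inequality for F;
   - x k(f) rho gives int k(f) x^alpha rho <= C (int k(f) rho + energy), by
     Young's inequality with exponents alpha and beta;
   - (x0 + 1 - x) k(f) rho over [x0, x0 + 1] bounds k(f) rho pointwise.
   Here k(y) = (1 + y^2) ((y^2 - 1) / (y^2 + 1))^q, q even and q >= beta, is
   comparable to y^2 for large y and vanishes to order q at y^2 = 1, which is
   what keeps the energy of k(f) below that of f.

   Normalize int f^2 dmu = 1.  Where f^2 < 2, the integrand
   f^2 ln f^2 - f^2 + 1 is at most 3 (f^2 - 1)^2 / (f^2 + 1), whose integral is
   bounded through the Poincare inequality.  Where f^2 >= 2,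
   ln f^2 <= C + (k(f) rho) + V and f^2 <= C k(f), and the last two estimates
   conclude. *)

Set Implicit Arguments.
Unset Strict Implicit.
Unset Printing Implicit Defensive.

Import Order.TTheory GRing.Theory Num.Theory.
Import numFieldNormedType.Exports.

Local Open Scope classical_set_scope.
Local Open Scope ring_scope.

(** * Calculus and integration *)

Section calculus.
Context {R : realType}.
Implicit Types (f g : R -> R) (x c : R).

Lemma is_derive_addf f g x a b : is_derive x 1 f a -> is_derive x 1 g b ->
  is_derive x 1 (fun y => f y + g y) (a + b).
Proof. by move=> ? ?; exact: is_deriveD. Qed.

Lemma is_derive_oppf f x a : is_derive x 1 f a ->
  is_derive x 1 (fun y => - f y) (- a).
Proof. by move=> ?; exact: is_deriveN. Qed.

Lemma is_derive_mulf f g x a b : is_derive x 1 f a -> is_derive x 1 g b ->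
  is_derive x 1 (fun y => f y * g y) (a * g x + f x * b).
Proof.
move=> fa gb; refine (is_derive_eq (is_deriveM fa gb) _).
by rewrite addrC /GRing.scale/= mulrC.
Qed.

Lemma is_derive_cstf c x : is_derive x 1 (fun=> c) 0.
Proof. exact: is_derive_cst. Qed.

Lemma is_derive_idf x : is_derive x 1 (fun y : R => y) 1.
Proof. exact: is_derive_id. Qed.

Lemma is_derive_compf f g x a b : is_derive x 1 g b -> is_derive (g x) 1 f a ->
  is_derive x 1 (fun y => f (g y)) (a * b).
Proof. by move=> gb fa; exact: is_derive1_comp. Qed.

Lemma is_derive_invf f x a : is_derive x 1 f a -> f x != 0 ->
  is_derive x 1 (fun y => (f y)^-1) (- a / f x ^+ 2).
Proof.
move=> fa fx0; refine (is_derive_eq (is_deriveV fx0 fa) _).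
by rewrite /GRing.scale/= !mulNr mulrC.
Qed.

Lemma is_derive_expf f x a n : is_derive x 1 f a ->
  is_derive x 1 (fun y => f y ^+ n.+1) (n.+1%:R * f x ^+ n * a).
Proof.
move=> fa; elim: n => [|n ih]; first by rewrite mul1r expr0 mul1r.
rewrite (_ : (fun y => _) = (fun y => f y * f y ^+ n.+1)); last first.
  by apply/funext => y; rewrite exprS.
refine (is_derive_eq (is_derive_mulf fa ih) _).
rewrite exprS (mulrSr 1 n.+1); ring.
Qed.

Lemma is_derive_continuous f df : (forall x, is_derive x 1 f (df x)) ->
  continuous f.
Proof.
move=> fdf x; apply: differentiable_continuous; apply/derivable1_diffP.
by have [] := fdf x.
Qed.

Lemma is_derive1_norm x : 0 < x -> is_derive x 1 (fun y : R => `|y|) 1.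
Proof.
move=> x0; have := is_derive_id x (1 : R); apply: near_eq_is_derive.
near=> y; rewrite gtr0_norm//; near: y.
exact: lt_nbhsr.
Unshelve. all: by end_near. Qed.

Lemma continuous_normr_powR (p : R) : 0 < p ->
  continuous (fun x : R => `|x| `^ p).
Proof.
(* At [0] the power need not be differentiable; there [|y| < e^(1/p)] gives [|y|^p < e] directly. *)
move=> p0 x; have [->|x0] := eqVneq x 0.
  rewrite /continuous_at normr0 powR0 ?gt_eqF//.
  apply/cvgr0Pnorm_lt => e e0; near=> y.
  rewrite ger0_norm ?powR_ge0//.
  have -> : e = (e `^ p^-1) `^ p.
    by rewrite -powRrM mulVf ?gt_eqF// powRr1// ltW.
  apply: gt0_ltr_powR; rewrite ?nnegrE ?powR_ge0//.
  near: y; apply: (@nbhs0_lt R R); exact: powR_gt0.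
apply: (@continuous_comp _ _ _ (fun x : R => `|x|) (fun y : R => y `^ p)).
  exact: norm_continuous.
apply: differentiable_continuous; apply/derivable1_diffP.
by apply: derivable_powR; rewrite in_itv/= andbT normr_gt0.
Unshelve. all: by end_near. Qed.

End calculus.

(** * Integral inequalities from derivatives, and integrals against a density *)

Section integration.
Context {R : realType}.
Local Notation leb := (@lebesgue_measure R).

(** The fundamental theorem of calculus turns [F b - F a] into the integral of [D].
    Differentiability is asked only inside the interval, since a potential built from [|x|] may have
    a corner at [0]. *)
Lemma integral_le_of_derive (A B D F : R -> R) (a b : R) : a < b ->
  continuous A -> continuous D -> continuous F ->
  measurable_fun [set: R] B -> (forall x, 0 <= B x) ->
  (forall x, a < x < b -> is_derive x 1 F (D x)) ->
  (forall x, a <= x <= b -> A x + D x <= B x) ->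
  (\int[leb]_(x in `[a, b]) (A x)%:E + (F b - F a)%:E
    <= \int[leb]_(x in `[a, b]) (B x)%:E)%E.
Proof.
move=> ab cA cD cF mB B0 dF AB.
have cint (f : R -> R) : continuous f -> leb.-integrable `[a, b] (EFin \o f).
  move=> cf; apply: continuous_compact_integrable; first exact: segment_compact.
  exact: continuous_subspaceT.
have mcE (f : R -> R) : continuous f -> measurable_fun `[a, b] (EFin \o f).
  move=> cf; apply/measurable_EFinP; apply: measurable_funTS.
  exact: continuous_measurable_fun.
have -> : ((F b - F a)%:E = \int[leb]_(x in `[a, b]) (D x)%:E)%E.
  rewrite (@continuous_FTC2 _ _ F)//.
  - exact: continuous_subspaceT.
  - split.
    + by move=> x /[!in_itv]/= /dF[].
    + exact/cvg_at_right_filter/cF.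
    + exact/cvg_at_left_filter/cF.
  - by move=> x /[!in_itv]/= /dF ?; rewrite derive1E derive_val.
have cAD : continuous (fun x => A x + D x).
  by move=> x; apply: continuousD; [exact: cA|exact: cD].
(* [B] is only measurable and may have infinite integral. The positive part of [A + D] is
   continuous, hence integrable, and lies below [B] because [B] is nonnegative. *)
have cmax : continuous (fun x => Num.max (A x + D x) 0).
  move=> x; apply: (@continuous_max _ _ (fun x => A x + D x) (fun=> 0)).
    exact: cAD.
  exact: cst_continuous.
rewrite -integralD//=; [|exact: cint..].
apply: (@le_trans _ _
  (\int[leb]_(x in `[a, b]) (Num.max (A x + D x) 0)%:E)%E).
  apply: le_integral => //.
  - exact: (cint (fun x => A x + D x)).
  - exact: (cint (fun x => Num.max (A x + D x) 0)).
  - by move=> x _; rewrite -EFinD lee_fin le_max lexx.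
apply: ge0_le_integral => //.
- by move=> x _; rewrite lee_fin le_max lexx orbT.
- exact: (mcE (fun x => Num.max (A x + D x) 0)).
- by apply/measurable_EFinP; exact: measurable_funTS.
- by move=> x /=; rewrite in_itv/= => xab; rewrite lee_fin ge_max AB// B0.
Qed.

(** Monotone convergence along [[0, n + 1]]; the shift keeps every interval nondegenerate, as
    [integral_le_of_derive] requires. *)
Lemma integral_itvcy_le (f : R -> R) (M : \bar R) :
  measurable_fun [set: R] f -> (forall x, 0 <= f x) ->
  (forall n : nat, (\int[leb]_(x in `[0%R, n.+1%:R]) (f x)%:E <= M)%E) ->
  (\int[leb]_(x in `[0%R, +oo[) (f x)%:E <= M)%E.
Proof.
move=> mf f0 fM.
have -> : `[0%R, +oo[%classic = \bigcup_n `[0%R, n.+1%:R]%classic :> set R.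
  apply/seteqP; split => [x /=|x [n _] /=]; rewrite !in_itv/= ?andbT; last first.
    by case/andP.
  move=> x0; exists (Num.truncn x) => //=; rewrite in_itv/= x0/= ltW//.
  by have /andP[] := Num.Theory.truncn_itv x0.
have mF i : measurable_fun (`[0%R, i.+1%:R]%classic : set R) (EFin \o f).
  by apply/measurable_EFinP; exact: measurable_funTS.
have nd : nondecreasing_seq (fun n : nat => `[0%R : R, n.+1%:R]%classic).
  move=> m n mn; apply/subsetPset => x /=; rewrite !in_itv/= => /andP[-> /le_trans->//].
  by rewrite ler_nat ltnS.
have f0' i x : `[0%R, i.+1%:R]%classic x -> (0 <= (f x)%:E)%E.
  by rewrite lee_fin.
have := @ge0_nondecreasing_set_cvg_integral _ _ _ _ _ leb nd
  (fun=> measurable_itv _) mF f0'.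
move=> /cvg_lim <-//.
apply: lime_le.
  apply: ereal_nondecreasing_is_cvgn.
  exact: (@ge0_nondecreasing_set_nondecreasing_integral _ _ _ _ _ leb nd
  (fun=> measurable_itv _) mF f0').
by apply: nearW => n; exact: fM.
Qed.

(** The measure is absolutely continuous, and uniqueness of densities identifies its Radon-Nikodym
    derivative with [w / Z] almost everywhere. *)
Lemma integral_normalized (w : R -> R) (nw : normalizable w) (f : R -> R) :
  measurable_fun [set: R] f -> (forall x, 0 <= f x) ->
  (\int[normalized nw]_x (f x)%:E =
   \int[leb]_x (f x * (w x / fine (total_mass w)))%:E)%E.
Proof.
move=> mf f0.
set Z := fine (total_mass w).
have Z0 : 0 < Z.
  by apply: fine_gt0; rewrite (normalizable_gt0 nw) (normalizable_lty nw).
have w0 x : 0 <= w x / Z by rewrite divr_ge0 ?(normalizable_ge0 nw)// ltW.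
have mw : measurable_fun [set: R] (fun x => w x / Z).
  by apply: measurable_funM => //; exact: normalizable_meas nw.
have dom : (normalized nw : measure _ _) `<< leb.
  apply/null_content_dominatesP => A mA A0.
  rewrite /= /normalized; apply: null_set_integral => //.
  by apply/measurable_EFinP; exact: measurable_funTS.
rewrite -(Radon_Nikodym_SigmaFinite.change_of_variables dom)//=; last first.
  exact/measurable_EFinP.
apply: ae_eq_integral => //.
- apply: emeasurable_funM; first exact/measurable_EFinP.
  apply: (measurable_int leb).
  exact: Radon_Nikodym_SigmaFinite.f_integrable.
- apply/measurable_EFinP; exact: measurable_funM.
- rewrite (_ : (fun x => (f x * _)%:E) = (fun x => (f x)%:E * (w x / Z)%:E)%E)//.
  apply: ae_eqe_mul2l.
  apply: integral_ae_eq => //.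
  + exact: Radon_Nikodym_SigmaFinite.f_integrable.
  + exact/measurable_EFinP.
  + by move=> E _ mE; rewrite -Radon_Nikodym_SigmaFinite.f_integral.
Qed.

End integration.

(** * The truncation and the energy density *)

Section truncation.
Context {R : realType}.
Variable m : nat.
Implicit Types y z : R.

Local Notation q := (m.+1.*2).

Definition contrast y : R := (y ^+ 2 - 1) / (y ^+ 2 + 1).

(* A smooth version of [y ^+ 2] cut off where [y ^+ 2 < 1]: it vanishes to order
   [q] at [y ^+ 2 = 1]. *)
Definition trunc_sq y : R := (1 + y ^+ 2) * contrast y ^+ q.

Definition dtrunc_sq y : R :=
  2 * y * contrast y ^+ q.-1 * (contrast y + 2 * q%:R / (y ^+ 2 + 1)).

(** Equal to [(y^2 - 1)^2 / (y^2 + 1)]. With [J = sqrt(1 + y^2)] it is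
    [((J + sqrt 2) / J)^2 (J - sqrt 2)^2], which is how a Poincare inequality for [J] controls
    it. *)
Definition fluct y : R := (1 + y ^+ 2) * contrast y ^+ 2.

Let sq1_gt0 y : 0 < y ^+ 2 + 1.
Proof. by rewrite ltr_wpDl// sqr_ge0. Qed.

Lemma contrast_norm_le1 y : `|contrast y| <= 1.
Proof.
rewrite /contrast normrM normfV (gtr0_norm (sq1_gt0 y)) ler_pdivrMr// mul1r.
by have := sqr_ge0 y; rewrite ler_norml; lra.
Qed.

Lemma contrast_sqr_le1 y : contrast y ^+ 2 <= 1.
Proof. by rewrite -real_normK ?num_real// exprn_ile1// contrast_norm_le1. Qed.

Lemma trunc_sqE y : trunc_sq y = (1 + y ^+ 2) * `|contrast y| ^+ q.
Proof. by rewrite /trunc_sq -muln2 mulnC !exprM real_normK ?num_real. Qed.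

Lemma trunc_sq_ge0 y : 0 <= trunc_sq y.
Proof.
by rewrite trunc_sqE mulr_ge0// addrC ltW.
Qed.

Lemma fluct_ge0 y : 0 <= fluct y.
Proof. by rewrite mulr_ge0 ?sqr_ge0// addrC ltW. Qed.

Lemma trunc_sq_le_fluct y : trunc_sq y <= fluct y.
Proof.
rewrite /trunc_sq /fluct ler_wpM2l//; first by rewrite addrC ltW.
rewrite -muln2 mulnC exprM exprS ler_piMr ?sqr_ge0//.
by rewrite exprn_ile1 ?sqr_ge0 ?contrast_sqr_le1.
Qed.

Lemma fluct_le y : fluct y <= 1 + y ^+ 2.
Proof.
by rewrite /fluct ler_piMr ?contrast_sqr_le1// addrC ltW.
Qed.

Lemma is_derive_contrast y :
  is_derive y 1 contrast (4 * y / (y ^+ 2 + 1) ^+ 2).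
Proof.
have h c : is_derive y 1 (fun z : R => z ^+ 2 + c) (2 * y).
  have := is_derive_addf (is_derive_expf 1 (is_derive_idf y)) (is_derive_cstf c y).
  by move=> /is_derive_eq; apply; rewrite expr1 addr0 mulr1.
have y0 : y ^+ 2 + 1 != 0 by rewrite gt_eqF.
have := is_derive_mulf (h (-1)) (is_derive_invf (h 1) y0).
by move=> /is_derive_eq; apply; field.
Qed.

Lemma is_derive_trunc_sq y : is_derive y 1 trunc_sq (dtrunc_sq y).
Proof.
have h : is_derive y 1 (fun z : R => 1 + z ^+ 2) (2 * y).
  have := is_derive_addf (is_derive_cstf 1 y) (is_derive_expf 1 (is_derive_idf y)).
  by move=> /is_derive_eq; apply; rewrite expr1 add0r mulr1.
have := is_derive_mulf h (is_derive_expf m.*2.+1 (is_derive_contrast y)).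
 move=> /is_derive_eq; apply; rewrite /dtrunc_sq doubleS/= exprS.
by field; rewrite gt_eqF.
Qed.

Lemma continuous_trunc_sq : continuous trunc_sq.
Proof. exact: is_derive_continuous is_derive_trunc_sq. Qed.

Lemma continuous_fluct : continuous fluct.
Proof.
have h y : is_derive y 1 (fun z : R => 1 + z ^+ 2) (2 * y).
  have := is_derive_addf (is_derive_cstf 1 y) (is_derive_expf 1 (is_derive_idf y)).
  by move=> /is_derive_eq; apply; rewrite expr1 add0r mulr1.
apply: (@is_derive_continuous _ _ (fun y => _)) => y.
exact: is_derive_mulf (h y) (is_derive_expf 1 (is_derive_contrast y)).
Qed.

Lemma continuous_dtrunc_sq : continuous dtrunc_sq.
Proof.
have h y : is_derive y 1 (fun z : R => z ^+ 2 + 1) (2 * y).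
  have := is_derive_addf (is_derive_expf 1 (is_derive_idf y)) (is_derive_cstf 1 y).
  by move=> /is_derive_eq; apply; rewrite expr1 addr0 mulr1.
apply: (@is_derive_continuous _ _ (fun y => _)) => y.
have y0 : y ^+ 2 + 1 != 0 by rewrite gt_eqF.
have h1 := is_derive_mulf (is_derive_cstf 2 y) (is_derive_idf y).
have h2 := is_derive_mulf h1 (is_derive_expf m.*2 (is_derive_contrast y)).
have h3 := is_derive_mulf (is_derive_cstf (2 * q%:R) y) (is_derive_invf (h y) y0).
exact: is_derive_mulf h2 (is_derive_addf (is_derive_contrast y) h3).
Qed.

(** Differentiation costs one power of the contrast; the remaining factor is at most [1 + 2 q]
    because both the contrast and [1 / (y^2 + 1)] are bounded by [1]. *)
Lemma dtrunc_sq_bound y :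
  `|dtrunc_sq y| <= 2 * (1 + 2 * q%:R) * (`|y| * `|contrast y| ^+ q.-1).
Proof.
have -> : `|dtrunc_sq y| = 2 * (`|y| * `|contrast y| ^+ q.-1) *
    `|contrast y + 2 * q%:R / (y ^+ 2 + 1)|.
  by rewrite /dtrunc_sq normrM normrM normrX normrM normr_nat !mulrA.
rewrite mulrAC ler_wpM2r// ?mulr_ge0// ler_wpM2l//.
apply: (le_trans (ler_normD _ _)); apply: lerD; first exact: contrast_norm_le1.
rewrite ger0_norm; last by rewrite divr_ge0// ?mulr_ge0// ltW.
rewrite ler_pdivrMr// ler_peMr ?mulr_ge0//.
by have := sqr_ge0 y; lra.
Qed.

End truncation.

(** * Pointwise bounds on the entropy integrand *)

Section entropy_bound.
Context {R : realType}.
Implicit Types g y : R.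

(** When [g] has integral [1], the terms [- g + 1] integrate to [0], so the entropy is unchanged
    while the integrand becomes nonnegative. The default [ln 0 = 0] gives the right value at
    [g = 0]. *)
Definition ent g : R := g * ln g - g + 1.

Lemma ent_ge0 g : 0 <= g -> 0 <= ent g.
Proof.
rewrite le_eqVlt => /predU1P[<-|g0]; rewrite /ent; first by rewrite mul0r; lra.
have : ln g^-1 <= g^-1 - 1.
  have := @le_ln1Dx R (g^-1 - 1); rewrite addrCA subrr addr0; apply.
  by rewrite ltrBrDl subrr invr_gt0.
rewrite lnV ?posrE// => h.
have : g * - ln g <= g * (g^-1 - 1) by rewrite ler_wpM2l// ltW.
by rewrite mulrBr mulfV ?gt_eqF//; lra.
Qed.

Lemma ent_le_sqr g : 0 <= g -> ent g <= (g - 1) ^+ 2.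
Proof.
rewrite le_eqVlt => /predU1P[<-|g0]; rewrite /ent.
  by rewrite mul0r; lra.
have : ln g <= g - 1.
  have := @le_ln1Dx R (g - 1); rewrite addrCA subrr addr0; apply.
  by lra.
move=> h; have : g * ln g <= g * (g - 1) by rewrite ler_wpM2l// ltW.
by rewrite expr2; lra.
Qed.

(** For large [y] the logarithm of [y^2] is compared with that of [trunc_sq m y]. The available
    bound [S] concerns [trunc_sq m y * expR (- V)], so the comparison costs an additional [V], hence
    the term [W]. *)
Lemma ent_le_trunc (m : nat) (W S V : R) y : 0 <= S -> V <= W -> 0 <= W ->
  trunc_sq m y * expR (- V) <= S ->
  ent (y ^+ 2) <= 3 * fluct y
    + 3 ^+ m.+1.*2 * trunc_sq m y * (ln (3 ^+ m.+1.*2) + S + W).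
Proof.
move=> S0 VW W0 kS; set q := m.+1.*2.
have L0 : 0 <= ln (3 ^+ q : R) by rewrite ln_ge0// exprn_ege1//; lra.
have LW0 : 0 <= ln (3 ^+ q : R) + S + W by rewrite !addr_ge0.
have q0 : 0 <= 3 ^+ q :> R by rewrite exprn_ge0.
have k0 := trunc_sq_ge0 m y.
have f0 := fluct_ge0 y.
have [y2|y2] := ltP (y ^+ 2) 2.
  apply: (@le_trans _ _ (3 * fluct y)); last first.
    by rewrite lerDl; apply: mulr_ge0 LW0; exact: mulr_ge0 q0 k0.
  apply: (le_trans (ent_le_sqr (sqr_ge0 _))).
  have y1 : 0 < y ^+ 2 + 1 by have := sqr_ge0 y; lra.
  have -> : (y ^+ 2 - 1) ^+ 2 = (1 + y ^+ 2) * fluct y.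
    by rewrite /fluct /contrast; field; rewrite gt_eqF.
  by rewrite ler_wpM2r//; lra.
have y0 : 0 < y ^+ 2 by lra.
(* From [y^2 >= 2] the contrast is at least [(2 - 1) / (2 + 1)]; its power [q] is the origin of the
   constant [3 ^+ q]. *)
have s3 : 3^-1 <= contrast y.
  by rewrite /contrast ler_pdivlMr; lra.
have yk : y ^+ 2 <= 3 ^+ q * trunc_sq m y.
  apply: (@le_trans _ _ (1 + y ^+ 2)); first lra.
  rewrite /trunc_sq mulrCA ler_peMr//; first lra.
  rewrite -exprMn exprn_ege1//; lra.
have kp : 0 < trunc_sq m y.
  rewrite lt_neqAle k0 andbT; apply/eqP => k_eq0.
  by move: yk; rewrite -k_eq0 mulr0; lra.
have kVp : 0 < trunc_sq m y * expR (- V) by exact: mulr_gt0 kp (expR_gt0 _).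
have lny : ln (y ^+ 2) <= ln (3 ^+ q : R) + S + W.
  apply: (@le_trans _ _ (ln (3 ^+ q * trunc_sq m y))).
    by rewrite ler_ln ?posrE// mulr_gt0// exprn_gt0.
  rewrite lnM ?posrE ?exprn_gt0// -addrA lerD2l.
  (* This exposes the quantity bounded by [S], whose logarithm is at most itself. *)
  have -> : trunc_sq m y = trunc_sq m y * expR (- V) * expR V.
    by rewrite -mulrA -expRD addrC subrr expR0 mulr1.
  rewrite lnM ?posrE ?expR_gt0// expRK lerD//.
  apply: le_trans kS; exact/ltW/ln_sublinear.
apply: (@le_trans _ _ (y ^+ 2 * ln (y ^+ 2))); first by rewrite /ent; lra.
have ln0 : 0 <= ln (y ^+ 2) by rewrite ln_ge0//; lra.
apply: (@le_trans _ _ (3 ^+ q * trunc_sq m y * (ln (3 ^+ q) + S + W))).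
  by apply: ler_pM => //; exact: ltW.
by rewrite lerDr mulr_ge0.
Qed.

End entropy_bound.

(** * The energy density for [a = 1], with [p = alpha - 1] *)

Section energy.
Context {R : realType}.
Variables (p beta : R).
Hypotheses (p_gt0 : 0 < p) (beta_ge2 : 2 <= beta) (pbeta : p * (beta - 1) = 1).
Implicit Types t x y z : R.

(* The integrand of the right-hand side of [LSI] at [f x = y], [f' x = z], with
   the convention [+oo * 0 = 0] made explicit. *)
Definition energy y z : R :=
  if y == 0 then 0 else Hfun 1 beta (z / y) * y ^+ 2.

Lemma Hfun1E t : Hfun 1 beta t =
  if `|t| <= 1 then t ^+ 2 / 2 else `|t| `^ beta / beta + (beta - 2) / (2 * beta).
Proof. by rewrite /Hfun powR1 mul1r expr1n mul1r. Qed.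

Let b0 : 0 < beta. Proof. exact: lt_le_trans beta_ge2. Qed.

Let sqrt_le_powR t : 1 <= t -> t ^+ 2 <= t `^ beta.
Proof. by move=> t1; rewrite -powR_mulrn ?ler_powR//; apply: le_trans t1. Qed.

Let powR_le_sqr t : 0 <= t <= 1 -> t `^ beta <= t ^+ 2.
Proof.
move=> /andP[]; rewrite le_eqVlt => /predU1P[<- _|t0 t1].
  by rewrite powR0 ?gt_eqF.
by rewrite -powR_mulrn ?ger_powR ?t0 ?t1// ltW.
Qed.

Lemma Hfun_ge0 t : 0 <= Hfun 1 beta t.
Proof.
rewrite Hfun1E; case: ifP => _; first by rewrite divr_ge0 ?sqr_ge0.
have h1 := powR_ge0 `|t| beta.
by rewrite addr_ge0// divr_ge0// ?subr_ge0// ?mulr_ge0// ltW.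
Qed.

(** For [|t| <= 1], where [Hfun] is quadratic, [beta >= 2] gives [|t|^beta <= t^2]; beyond [1] the
    power term suffices, the additive constant being nonnegative. *)
Lemma powR_le_Hfun t : `|t| `^ beta <= beta * Hfun 1 beta t.
Proof.
rewrite Hfun1E; case: ifPn => [t1|_].
  apply: (@le_trans _ _ (t ^+ 2)).
    by rewrite -[leRHS]real_normK ?num_real// powR_le_sqr// normr_ge0.
  have : 2 * (t ^+ 2 / 2) <= beta * (t ^+ 2 / 2).
    by rewrite ler_wpM2r// divr_ge0// sqr_ge0.
  lra.
rewrite mulrDr mulrCA divff ?gt_eqF// mulr1 lerDl.
by rewrite mulr_ge0 ?divr_ge0 ?subr_ge0 ?mulr_ge0// ltW.
Qed.

Lemma sqr_le_Hfun t : t ^+ 2 <= beta * Hfun 1 beta t.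
Proof.
have [t1|/ltW t1] := leP `|t| 1; last first.
  by apply: le_trans (powR_le_Hfun t); rewrite -real_normK ?num_real// sqrt_le_powR.
rewrite Hfun1E t1.
have : 2 * (t ^+ 2 / 2) <= beta * (t ^+ 2 / 2).
  by rewrite ler_wpM2r// divr_ge0// sqr_ge0.
lra.
Qed.

Lemma energy_ge0 y z : 0 <= energy y z.
Proof.
by rewrite /energy; case: ifP => _ //; rewrite mulr_ge0 ?Hfun_ge0 ?sqr_ge0.
Qed.

Lemma energyN y z : energy y (- z) = energy y z.
Proof. by rewrite /energy mulNr /Hfun normrN sqrrN. Qed.

(** This homogeneity permits the normalization [int f^2 dmu = 1]. *)
Lemma energyZ (c : R) y z : c != 0 ->
  energy (c * y) (c * z) = c ^+ 2 * energy y z.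
Proof.
move=> c0; rewrite /energy mulf_eq0 (negbTE c0)/=.
case: ifPn => y0; first by rewrite mulr0.
rewrite exprMn mulrCA; congr (_ * (Hfun _ _ _ * _)).
by field; rewrite y0 c0.
Qed.

(** The condition [y != 0] is essential: [energy] is [0] at a zero of [f], even if the derivative is
    not. *)
Lemma sqr_le_energy y z : y != 0 -> z ^+ 2 <= beta * energy y z.
Proof.
move=> y0; rewrite /energy (negbTE y0) mulrA.
have -> : z ^+ 2 = (z / y) ^+ 2 * y ^+ 2 by field.
by rewrite ler_wpM2r ?sqr_ge0// sqr_le_Hfun.
Qed.

Lemma powR_le_energy y z : y != 0 ->
  `|z / y| `^ beta * y ^+ 2 <= beta * energy y z.
Proof.
move=> y0; rewrite /energy (negbTE y0) mulrA.
by rewrite ler_wpM2r ?sqr_ge0// powR_le_Hfun.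
Qed.

(** At [y = 0] the factor [y] of [dtrunc_sq] makes the left side vanish, in agreement with [energy];
    elsewhere [|y| |z| <= y^2 + z^2]. *)
Lemma dtrunc_sq_le_energy (m : nat) y z :
  `|dtrunc_sq m y * z| <= 2 * (1 + 2 * m.+1.*2%:R) * (y ^+ 2 + beta * energy y z).
Proof.
have [->|y0] := eqVneq y 0.
  rewrite /dtrunc_sq mulr0 !mul0r normr0; apply: mulr_ge0.
    by rewrite mulr_ge0 ?addr_ge0 ?mulr_ge0.
  exact: addr_ge0 (sqr_ge0 _) (mulr_ge0 (ltW b0) (energy_ge0 _ _)).
rewrite normrM; apply: (le_trans (ler_wpM2r (normr_ge0 z) (dtrunc_sq_bound m y))).
rewrite -[leLHS]mulrA ler_wpM2l//.
apply: (@le_trans _ _ (`|y| * `|z|)).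
  rewrite ler_wpM2r// ler_piMr//.
  by rewrite exprn_ile1// contrast_norm_le1.
apply: (@le_trans _ _ (y ^+ 2 + z ^+ 2)); last by rewrite lerD2l sqr_le_energy.
rewrite -(real_normK (num_real y)) -(real_normK (num_real z)).
have := sqr_ge0 (`|y| - `|z|); rewrite sqrrB.
have := mulr_ge0 (normr_ge0 y) (normr_ge0 z); lra.
Qed.

(* Either t <= d s x^p, or (x s^(1/p)) <= (t / d)^(1/p), where 1/p = beta - 1
   and 1 + 1/p = beta. *)
Lemma young_weighted (n : nat) (d : R) : 0 < d -> beta <= n.+2%:R ->
  exists2 C : R, 0 <= C & forall s t x : R, 0 <= s <= 1 -> 0 <= t -> 0 <= x ->
    s ^+ n.+1 * t * x <= d * s ^+ n.+2 * (x * x `^ p) + C * t `^ beta.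
Proof.
move=> d0 bn; exists (d^-1 `^ (beta - 1)); first exact: powR_ge0.
move=> s t x /andP[s0 s1] t0 x0.
have [h|/ltW h] := leP t (d * s * x `^ p).
  apply: (@le_trans _ _ (d * s ^+ n.+2 * (x * x `^ p))); last first.
    by rewrite lerDl mulr_ge0 ?powR_ge0.
  have := ler_wpM2l (mulr_ge0 (exprn_ge0 n.+1 s0) x0) h.
  by rewrite [s ^+ n.+2]exprS; lra.
apply: (@le_trans _ _ (d^-1 `^ (beta - 1) * t `^ beta)); last first.
  rewrite lerDr; apply: mulr_ge0; last by rewrite mulr_ge0// powR_ge0.
  exact: mulr_ge0 (ltW d0) (exprn_ge0 _ s0).
have [->|sn0] := eqVneq s 0.
  rewrite expr0n/= !mul0r. by apply: mulr_ge0; apply: powR_ge0.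
have sp : 0 < s by rewrite lt_neqAle eq_sym sn0.
have h1 : s `^ (beta - 1) * x <= (d^-1 * t) `^ (beta - 1).
  have -> : s `^ (beta - 1) * x = (s * x `^ p) `^ (beta - 1).
    by rewrite powRM ?powR_ge0// -powRrM pbeta powRr1.
  apply: ge0_ler_powR; rewrite ?nnegrE ?mulr_ge0 ?powR_ge0 ?invr_ge0 ?(ltW d0)//.
    by have := beta_ge2; lra.
  by rewrite (mulrC d^-1) ler_pdivlMr// mulrC mulrA.
(* The order of vanishing enters here: [beta - 1 <= n + 1] and [s <= 1]. *)
have h2 : s ^+ n.+1 <= s `^ (beta - 1).
  rewrite -powR_mulrn//; apply: ger_powR; rewrite ?sp//.
  by rewrite lerBlDr natr1.
have h3 : s ^+ n.+1 * x <= (d^-1 * t) `^ (beta - 1).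
  by apply: le_trans h1; rewrite ler_wpM2r.
rewrite mulrAC; apply: (le_trans (ler_wpM2r t0 h3)).
rewrite powRM ?invr_ge0 ?(ltW d0)// -mulrA (mulrC _ t) mulr_powRB1//.
Qed.

(** Apply [young_weighted] to the relative slope [t = |z / y|] and to [s = |contrast y|], then
    multiply by [K y^2]: the energy controls [t^beta y^2], and [y^2 s^q] is below [trunc_sq]. *)
Lemma dtrunc_sq_young (m : nat) (d : R) : 0 < d -> beta <= m.+1.*2%:R ->
  exists2 C : R, 0 <= C & forall x y z, 0 <= x ->
    `|dtrunc_sq m y * z| * x <=
      d * (trunc_sq m y * (x * x `^ p)) + C * energy y z.
Proof.
move=> d0 bq; pose K : R := 2 * (1 + 2 * m.+1.*2%:R).
have K0 : 0 < K by rewrite mulr_gt0// ltr_wpDr// mulr_ge0.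
(* Here [m.*2.+1] and [m.*2.+2] are [q - 1] and [q]; dividing [d] by [K] cancels the constant of
   [dtrunc_sq_bound]. *)
have [C C0 HC] := @young_weighted m.*2 (d / K) (divr_gt0 d0 K0) bq.
have KC : 0 <= K * C by rewrite mulr_ge0// ltW.
have KCb : 0 <= K * C * beta := mulr_ge0 KC (ltW b0).
exists (K * C * beta) => //.
move=> x y z x0.
have k0 := trunc_sq_ge0 m y; have P0 := energy_ge0 y z.
have [->|y0] := eqVneq y 0.
  rewrite /dtrunc_sq mulr0 !mul0r normr0 mul0r.
  apply: addr_ge0; last exact: mulr_ge0 KCb (energy_ge0 _ _).
  by rewrite (mulr_ge0 (ltW d0))// mulr_ge0 ?trunc_sq_ge0// mulr_ge0 ?powR_ge0.
set t := `|z / y|; set s := `|contrast y|.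
have zE : `|z| = t * `|y| by rewrite -normrM divfK.
rewrite normrM zE.
have h1 := dtrunc_sq_bound m y; rewrite -/K -/s in h1.
have ty0 : 0 <= t * `|y| * x.
  by apply: mulr_ge0 x0; exact: mulr_ge0 (normr_ge0 _) (normr_ge0 _).
rewrite -[leLHS]mulrA; apply: (le_trans (ler_wpM2r ty0 h1)).
have h2 := HC s t x; rewrite contrast_norm_le1 normr_ge0 in h2.
have {h2} := h2 isT (normr_ge0 _) x0 => h2.
have y2 : 0 <= K * `|y| ^+ 2 by rewrite mulr_ge0 ?sqr_ge0// ltW.
have := ler_wpM2l y2 h2.
rewrite mulrDr => h3.
have -> : K * (`|y| * s ^+ m.+1.*2.-1) * (t * `|y| * x) =
    K * `|y| ^+ 2 * (s ^+ m.*2.+1 * t * x) by rewrite doubleS/=; ring.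
apply: (le_trans h3); apply: lerD.
  have -> : K * `|y| ^+ 2 * (d / K * s ^+ m.*2.+2 * (x * x `^ p)) =
      d * (`|y| ^+ 2 * s ^+ m.*2.+2 * (x * x `^ p)) by field; rewrite gt_eqF.
  rewrite (ler_wpM2l (ltW d0))// ler_wpM2r ?mulr_ge0 ?powR_ge0//.
  rewrite trunc_sqE real_normK ?num_real// doubleS ler_wpM2r ?exprn_ge0 ?normr_ge0//.
  by rewrite lerDr.
have := powR_le_energy z y0; rewrite -/t => h4.
have := ler_wpM2l KC h4; rewrite real_normK ?num_real//; lra.
Qed.

Lemma measurable_energy (f df : R -> R) : continuous f -> continuous df ->
  measurable_fun [set: R] (fun x => energy (f x) (df x)).
Proof.
move=> cf cdf.
have mf : measurable_fun [set: R] f by exact: continuous_measurable_fun.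
have mdf : measurable_fun [set: R] df by exact: continuous_measurable_fun.
(* Inversion is continuous off [0] only, so the point [0] is split off by a conditional. *)
have mi : measurable_fun [set: R] (fun x : R => x^-1).
  rewrite (_ : (fun x => _) = (fun x : R => if x == 0 then 0 else x^-1)); last first.
    by apply/funext => x; case: eqVneq => // ->; rewrite invr0.
  apply: measurable_fun_if => //.
  - exact: measurable_fun_eqr.
  - rewrite setTI; apply: open_continuous_measurable_fun.
      rewrite (_ : _ @^-1` _ = [set x : R | x != 0]); first exact: open_neq.
      by apply/seteqP; split => x /=; case: eqP.
    by move=> x; rewrite inE/= => /negbT x0; exact: inv_continuous.
have mH : measurable_fun [set: R] (Hfun 1 beta).
  apply: measurable_fun_if => //.
  - exact: measurable_fun_ler.
  - by apply: measurable_funTS; apply: measurable_funM => //; exact: measurable_funX.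
  - apply: measurable_funTS; apply: measurable_funD => //.
    apply: measurable_funM => //; apply: measurable_funM => //.
    by apply: (measurableT_comp (measurable_powR _)); exact: normr_measurable.
apply: measurable_fun_if => //.
- apply: measurable_fun_eqr => //.
- apply: measurable_funTS; apply: measurable_funM; last exact: measurable_funX.
  apply: (measurableT_comp mH); apply: measurable_funM => //.
  exact: measurableT_comp.
Qed.

End energy.

(** * Weighted inequalities on a half-line *)

Ltac nonneg := repeat match goal with
  | |- _ => assumption
  | |- is_true (0 <= _ + _) => apply: addr_ge0
  | |- is_true (0 <= _ * _) => apply: mulr_ge0
  end; try by [].

Section continuity.
Context {R : realType}.
Implicit Types f g : R -> R.

Lemma continuous_addf f g : continuous f -> continuous g ->
  continuous (fun x => f x + g x).
Proof. by move=> cf cg x; apply: continuousD; [exact: cf|exact: cg]. Qed.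

Lemma continuous_oppf f : continuous f -> continuous (fun x => - f x).
Proof. by move=> cf x; apply: continuousN; exact: cf. Qed.

Lemma continuous_mulf f g : continuous f -> continuous g ->
  continuous (fun x => f x * g x).
Proof. by move=> cf cg x; apply: continuousM; [exact: cf|exact: cg]. Qed.

Lemma continuous_cstf (c : R) : continuous (fun _ : R => c).
Proof. exact: cst_continuous. Qed.

Lemma continuous_idf : continuous (fun x : R => x).
Proof. by move=> x. Qed.

Lemma continuous_compf f g : continuous f -> continuous g ->
  continuous (fun x => f (g x)).
Proof. by move=> cf cg x; apply: continuous_comp; [exact: cg|exact: cf]. Qed.

End continuity.

(** * The smooth modulus [sqrt(1 + y^2)] *)

Section root.
Context {R : realType}.
Implicit Types y z : R.

Definition jbracket y : R := Num.sqrt (1 + y ^+ 2).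

Lemma jbracket_gt0 y : 0 < jbracket y.
Proof. by rewrite sqrtr_gt0 ltr_pwDl// sqr_ge0. Qed.

Lemma jbracket_sqr y : jbracket y ^+ 2 = 1 + y ^+ 2.
Proof. by rewrite sqr_sqrtr// addr_ge0// sqr_ge0. Qed.

Lemma is_derive_jbracket y : is_derive y 1 jbracket (y / jbracket y).
Proof.
have h : is_derive y 1 (fun z : R => 1 + z ^+ 2) (2 * y).
  have := is_derive_addf (is_derive_cstf 1 y) (is_derive_expf 1 (is_derive_idf y)).
  by move=> /is_derive_eq; apply; rewrite expr1 add0r mulr1.
have y0 : 0 < 1 + y ^+ 2 by rewrite ltr_pwDl// sqr_ge0.
have := is_derive_compf h (is_derive1_sqrt y0).
move=> /is_derive_eq; apply; rewrite -/(jbracket y).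
by field; rewrite gt_eqF// jbracket_gt0.
Qed.

Lemma continuous_jbracket : continuous jbracket.
Proof. exact: is_derive_continuous is_derive_jbracket. Qed.

Lemma continuous_djbracket : continuous (fun y : R => y / jbracket y).
Proof.
apply: (@is_derive_continuous _ _ (fun y => _)) => y.
have y0 : jbracket y != 0 by rewrite gt_eqF// jbracket_gt0.
exact: is_derive_mulf (is_derive_idf y) (is_derive_invf (is_derive_jbracket y) y0).
Qed.

(** The factor [y / jbracket y] vanishes at [y = 0], where [energy] is [0] whatever [z]; this is why
    the Poincare inequality is stated for [jbracket (f x)] and not for [f x]. *)
Lemma djbracket_sqr_le_energy (beta : R) y z : 2 <= beta ->
  (y / jbracket y * z) ^+ 2 <= beta * energy beta y z.
Proof.
move=> b2; have [->|y0] := eqVneq y 0.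
  by rewrite !mul0r expr0n/= mulr_ge0 ?energy_ge0//; exact: le_trans b2.
apply: le_trans (sqr_le_energy b2 z y0).
rewrite exprMn ler_piMl ?sqr_ge0// expr_div_n jbracket_sqr ler_pdivrMr.
  by rewrite mul1r lerDr.
by rewrite ltr_pwDl// sqr_ge0.
Qed.

End root.

(** * Weighted integrals and functional inequalities on the half-line *)

Section halfline_functionals.
Context {R : realType}.
Implicit Types (x : R) (phi V f df : R -> R).

Definition meas_ge0 phi := measurable_fun [set: R] phi /\ forall x, 0 <= phi x.

Lemma meas_ge0_continuous phi :
  continuous phi -> (forall x, 0 <= phi x) -> meas_ge0 phi.
Proof. by move=> cphi phi0; split => //; exact: continuous_measurable_fun. Qed.

Definition halfint V phi : \bar R :=
  (\int[lebesgue_measure]_(x in `[0%R, +oo[) (phi x * expR (- V x))%:E)%E.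

(** The centre is the value at [0] and not a mean: the Lyapunov function then vanishes at [0], and
    the two half-lines of the line share one centre. *)
Definition weighted_poincare V (beta : R) := exists2 C : R, 0 <= C &
  forall f df, (forall x, is_derive x 1 f (df x)) -> continuous df ->
  forall s : R, (halfint V (fun x => energy beta (f x) (df x)) <= s%:E)%E ->
  (halfint V (fun x => ((jbracket (f x) - jbracket (f 0)) ^+ 2)%R) <= (C * s)%:E)%E.

(** The natural estimate is quadratic, a supremum times an integral. The a priori bound [L] on the
    mass, which also bounds [r], makes it linear in [r + s], with [C] depending on [L] but not on
    [f]. *)
Definition weighted_entropy V (beta : R) := forall L : R, 0 <= L ->
  exists2 C : R, 0 <= C &
  forall f df, (forall x, is_derive x 1 f (df x)) -> continuous df ->
  forall r s : R, 0 <= r <= L -> 0 <= s ->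
  (halfint V (fun x => (1 + f x ^+ 2)%R) <= L%:E)%E ->
  (halfint V (fun x => fluct (f x)) <= r%:E)%E ->
  (halfint V (fun x => energy beta (f x) (df x)) <= s%:E)%E ->
  (halfint V (fun x => ent (f x ^+ 2)%R) <= (C * (r + s))%:E)%E.

End halfline_functionals.

(** * The Lyapunov argument on one half-line *)

Section halfline.
Context {R : realType}.
Local Notation leb := (@lebesgue_measure R).
Implicit Types x y z : R.

Variables (p beta : R) (m : nat) (V dV : R -> R) (c M K : R).
Hypotheses (p_gt0 : 0 < p) (beta_ge2 : 2 <= beta) (pbeta : p * (beta - 1) = 1).
Hypothesis beta_le : beta <= m.+1.*2%:R.
Hypotheses (c_gt0 : 0 < c) (M_ge0 : 0 <= M) (K_ge0 : 0 <= K).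
Hypotheses (cV : continuous V) (cdV : continuous dV).
Hypothesis V_derive : forall x, 0 < x -> is_derive x 1 V (dV x).
Hypothesis dV_ge : forall x, 0 <= x -> c * `|x| `^ p - M <= dV x.
Hypothesis dV_le : forall x, 0 <= x -> `|dV x| <= K * (1 + `|x| * `|x| `^ p).
Hypothesis V_le : forall x, 0 <= x -> V x <= K * (1 + `|x| * `|x| `^ p).

Let rho x := expR (- V x).

Local Notation halfint := (halfint V).

Let rho_gt0 x : 0 < rho x. Proof. exact: expR_gt0. Qed.

Let crho : continuous rho.
Proof.
by apply: continuous_compf (continuous_oppf cV); exact: continuous_expR.
Qed.

Let drho x : 0 < x -> is_derive x 1 rho (- dV x * rho x).
Proof.
move=> /V_derive/is_derive_oppf hV.
have := is_derive_compf hV (is_derive_expR (- V x)).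
by move=> /is_derive_eq; apply; rewrite mulrC.
Qed.

Let mrho (phi : R -> R) : meas_ge0 phi -> meas_ge0 (fun x => phi x * rho x).
Proof.
move=> [mphi phi0]; split.
  by apply: measurable_funM => //; exact: continuous_measurable_fun.
by move=> x; rewrite mulr_ge0// ltW.
Qed.

(** Integrals are compared through real upper bounds, so that infinite values never enter the
    arithmetic. *)
Lemma halfint_lin (chi phi psi : R -> R) (a b r s : R) :
  meas_ge0 chi -> meas_ge0 phi -> meas_ge0 psi -> 0 <= a -> 0 <= b ->
  (forall x, 0 <= x -> chi x <= a * phi x + b * psi x) ->
  (halfint phi <= r%:E -> halfint psi <= s%:E -> halfint chi <= (a * r + b * s)%:E)%E.
Proof.
move=> /mrho[mchi chi0] /mrho[mphi phi0] /mrho[mpsi psi0] a0 b0 le_chi hr hs.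
have mE (g : R -> R) D : measurable_fun [set: R] g -> measurable_fun D (EFin \o g).
  by move=> mg; apply/measurable_EFinP; exact: measurable_funTS.
apply: (@le_trans _ _ (\int[leb]_(x in `[0%R, +oo[)
    (a%:E * (phi x * rho x)%:E + b%:E * (psi x * rho x)%:E))%E).
  apply: ge0_le_integral => //.
  - by move=> x _; rewrite lee_fin.
  - exact: mE.
  - by apply: emeasurable_funD; apply: measurable_funeM; exact: mE.
  - move=> x /=; rewrite in_itv/= andbT => x0.
    rewrite -!EFinM -EFinD lee_fin !mulrA -mulrDl.
    exact: ler_wpM2r (ltW (rho_gt0 x)) _ _ (le_chi _ x0).
rewrite ge0_integralD//=; last 4 first.
- by move=> x _; rewrite mule_ge0// lee_fin.
- by apply: measurable_funeM; exact: mE.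
- by move=> x _; rewrite mule_ge0// lee_fin.
- by apply: measurable_funeM; exact: mE.
rewrite !ge0_integralZl_EFin//; last 4 first.
- by move=> x _; rewrite lee_fin.
- exact: mE.
- by move=> x _; rewrite lee_fin.
- exact: mE.
by rewrite EFinD !EFinM leeD// lee_wpmul2l.
Qed.

(** Integrate the pointwise inequality over [[0, n + 1]]. The boundary term [F n.+1 - F 0] is
    nonnegative and is dropped, so no decay of [F] has to be known before [n] goes to infinity. *)
Lemma halfint_lyapunov (D F chi phi psi : R -> R) (a b r s : R) :
  continuous chi -> (forall x, 0 <= chi x) -> meas_ge0 phi -> meas_ge0 psi ->
  0 <= a -> 0 <= b ->
  continuous D -> continuous F -> (forall x, 0 < x -> is_derive x 1 F (D x)) ->
  (forall x, 0 <= x -> F 0 <= F x) ->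
  (forall x, 0 <= x -> chi x * rho x + D x <= (a * phi x + b * psi x) * rho x) ->
  (halfint phi <= r%:E -> halfint psi <= s%:E -> halfint chi <= (a * r + b * s)%:E)%E.
Proof.
move=> cchi chi0 mphi mpsi a0 b0 cD cF dF F0 le_chi hr hs.
have ms : meas_ge0 (fun x => a * phi x + b * psi x).
  case: mphi mpsi => [mphi phi0] [mpsi psi0]; split.
    by apply: measurable_funD; exact: measurable_funM.
  by move=> x; rewrite addr_ge0// mulr_ge0.
have [msr sr0] := mrho ms.
apply: le_trans (halfint_lin ms mphi mpsi a0 b0 (fun _ _ => lexx _) hr hs).
have cA : continuous (fun x => chi x * rho x) by exact: continuous_mulf.
apply: integral_itvcy_le.
- exact: continuous_measurable_fun.
- by move=> x; rewrite mulr_ge0// ltW.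
move=> n.
apply: (@le_trans _ _ (\int[leb]_(x in `[0%R, n.+1%:R])
   ((a * phi x + b * psi x) * rho x)%:E)%E); last first.
  apply: ge0_subset_integral => //.
  - by apply/measurable_EFinP; exact: measurable_funTS.
  - by move=> x _; rewrite lee_fin.
  - by move=> x /=; rewrite !in_itv/= andbT => /andP[].
have := @integral_le_of_derive R (fun x => chi x * rho x)
  (fun x => (a * phi x + b * psi x) * rho x) D F 0 n.+1%:R.
move=> /(_ (ltr0Sn _ _) cA cD cF msr sr0).
have hd x : 0 < x < n.+1%:R -> is_derive x 1 F (D x) by case/andP=> /dF.
have hle x : 0 <= x <= n.+1%:R ->
  chi x * rho x + D x <= (a * phi x + b * psi x) * rho x.
  by case/andP => /le_chi.
move=> /(_ hd hle); apply: le_trans.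
by rewrite leeDl// lee_fin subr_ge0 F0.
Qed.

(** Integrate over [[x0, x0 + 1]] only, then enlarge the right side to the half-line: with [F]
    vanishing at [x0 + 1], integral bounds become a pointwise bound. *)
Lemma halfint_sup (D F phi psi : R -> R) (a b r s x0 : R) : 0 <= x0 ->
  meas_ge0 phi -> meas_ge0 psi -> 0 <= a -> 0 <= b ->
  continuous D -> continuous F -> (forall x, 0 < x -> is_derive x 1 F (D x)) ->
  (forall x, x0 <= x <= x0 + 1 -> D x <= (a * phi x + b * psi x) * rho x) ->
  (halfint phi <= r%:E -> halfint psi <= s%:E ->
   (F (x0 + 1) - F x0)%:E <= (a * r + b * s)%:E)%E.
Proof.
move=> x00 mphi mpsi a0 b0 cD cF dF le_D hr hs.
have ms : meas_ge0 (fun x => a * phi x + b * psi x).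
  case: mphi mpsi => [mphi phi0] [mpsi psi0]; split.
    by apply: measurable_funD; exact: measurable_funM.
  by move=> x; rewrite addr_ge0// mulr_ge0.
have [msr sr0] := mrho ms.
apply: le_trans (halfint_lin ms mphi mpsi a0 b0 (fun _ _ => lexx _) hr hs).
apply: (@le_trans _ _ (\int[leb]_(x in `[x0, (x0 + 1)%R])
   ((a * phi x + b * psi x) * rho x)%:E)%E); last first.
  apply: ge0_subset_integral => //.
  - by apply/measurable_EFinP; exact: measurable_funTS.
  - by move=> x _; rewrite lee_fin.
  - by move=> x /=; rewrite !in_itv/= andbT => /andP[+ _]; exact: le_trans.
have := @integral_le_of_derive R (fun=> 0)
  (fun x => (a * phi x + b * psi x) * rho x) D F x0 (x0 + 1).
have x01 : x0 < x0 + 1 by rewrite ltrDl.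
move=> /(_ x01 (@continuous_cstf R 0) cD cF msr sr0).
have hd x : x0 < x < x0 + 1 -> is_derive x 1 F (D x).
  by case/andP=> /(le_lt_trans x00)/dF.
have hle x : x0 <= x <= x0 + 1 -> 0 + D x <= (a * phi x + b * psi x) * rho x.
  by rewrite add0r; exact: le_D.
move=> /(_ hd hle); apply: le_trans.
by rewrite integral0 add0e.
Qed.

(** This is [|x|^alpha], as [alpha = p + 1]; the product form matches the factor [x] times the drift
    [x^p]. *)
Let X (x : R) : R := `|x| * `|x| `^ p.

Let X_ge0 x : 0 <= X x. Proof. by rewrite mulr_ge0// powR_ge0. Qed.

Let cX : continuous X.
Proof.
apply: continuous_mulf; last exact: continuous_normr_powR.
exact: norm_continuous.
Qed.

Section one_function.
Variables (f df : R -> R).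
Hypotheses (f_derive : forall x, is_derive x 1 f (df x)) (cdf : continuous df).

Let cf : continuous f. Proof. exact: is_derive_continuous f_derive. Qed.

Let k x := trunc_sq m (f x).
Let dk x := dtrunc_sq m (f x) * df x.
Let P x := energy beta (f x) (df x).

Let k_ge0 x : 0 <= k x. Proof. exact: trunc_sq_ge0. Qed.

Let P_ge0 x : 0 <= P x. Proof. exact: energy_ge0. Qed.

Let k_derive x : is_derive x 1 k (dk x).
Proof. exact: is_derive_compf (f_derive x) (is_derive_trunc_sq m (f x)). Qed.

Let ck : continuous k. Proof. exact: is_derive_continuous k_derive. Qed.

Let cdk : continuous dk.
Proof.
apply: continuous_mulf => //; apply: continuous_compf => //.
exact: continuous_dtrunc_sq.
Qed.

Lemma meas_ge0_energy : meas_ge0 P.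
Proof. by split => //; exact: measurable_energy. Qed.

Let meas_ge0_k : meas_ge0 k. Proof. exact: meas_ge0_continuous. Qed.

(* Integrate the derivative of [x k(x) rho(x)]. *)
Lemma halfint_moment (C1 C2 r s : R) : 0 <= C1 -> 0 <= C2 ->
  (forall x, 0 <= x -> M * x <= c / 4 * X x + C1) ->
  (forall x y z, 0 <= x -> `|dtrunc_sq m y * z| * x <=
      c / 4 * (trunc_sq m y * (x * x `^ p)) + C2 * energy beta y z) ->
  (halfint k <= r%:E -> halfint P <= s%:E ->
   halfint (fun x => (c / 2 * (k x * X x))%R) <= ((1 + C1) * r + C2 * s)%:E)%E.
Proof.
move=> C10 C20 H1 H2.
have ci := @continuous_idf R.
pose F x := k x * x * rho x.
pose D x := (dk x * x + k x - k x * x * dV x) * rho x.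
apply: (@halfint_lyapunov D F).
- do 2 apply: continuous_mulf => //; exact: continuous_cstf.
- move=> x; apply: mulr_ge0 _ (mulr_ge0 (k_ge0 x) (X_ge0 x)).
  by rewrite divr_ge0// ltW.
- exact: meas_ge0_k.
- exact: meas_ge0_energy.
- by rewrite addr_ge0.
- by [].
- apply: continuous_mulf crho; apply: continuous_addf.
    exact: continuous_addf (continuous_mulf cdk ci) ck.
  exact: continuous_oppf (continuous_mulf (continuous_mulf ck ci) cdV).
- exact: continuous_mulf (continuous_mulf ck ci) crho.
- move=> x x0.
  have := is_derive_mulf (is_derive_mulf (k_derive x) (is_derive_idf x)) (drho x0).
  by move=> /is_derive_eq; apply; rewrite /D; ring.
- by move=> x x0; rewrite /F mulr0 mul0r (mulr_ge0 (mulr_ge0 _ x0))// ltW.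
- move=> x x0; rewrite /D -mulrDl ler_wpM2r// ?(ltW (rho_gt0 _))//.
  (* The drift supplies [c k X]. A quarter of [c] pays for [M x k] through [H1], another quarter for
     the derivative of [k] through [H2], and [c / 2] remains. *)
  have := H2 x (f x) (df x) x0; rewrite -/(k x) -/(P x) => h2.
  have h2' : dk x * x <= `|dtrunc_sq m (f x) * df x| * x.
    by rewrite ler_wpM2r// ler_norm.
  have h1 := ler_wpM2l (k_ge0 x) (H1 x x0).
  have h3 := ler_wpM2l (mulr_ge0 (k_ge0 x) x0) (dV_ge x0).
  move: h1 h3; rewrite /X ger0_norm// => h1 h3.
  have -> : (1 + C1) * k x + C2 * P x = k x + C1 * k x + C2 * P x by ring.
  rewrite -/(k x) -/(P x) in h2.
  by lra.
Qed.

Let meas_ge0_kX : meas_ge0 (fun x => k x * (1 + X x)).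
Proof.
apply: meas_ge0_continuous.
  exact: continuous_mulf ck (continuous_addf (@continuous_cstf R 1) cX).
by move=> x; rewrite mulr_ge0// addr_ge0.
Qed.

Let meas_ge0_fP : meas_ge0 (fun x => f x ^+ 2 + beta * P x).
Proof.
have cf2 : continuous (fun x => f x ^+ 2) by exact: continuous_mulf.
have [mP _] := meas_ge0_energy; split.
  apply: measurable_funD; first exact: continuous_measurable_fun.
  exact: measurable_funM.
move=> x; rewrite addr_ge0 ?sqr_ge0// mulr_ge0//.
exact: le_trans beta_ge2.
Qed.

(* Integrate the derivative of [(x0 + 1 - x) k(x) rho(x)] over
   [x0 <= x <= x0 + 1]. *)
Lemma halfint_sup_trunc (C r s x0 : R) : 0 <= x0 -> 0 <= C ->
  (forall y z, `|dtrunc_sq m y * z| <= C * (y ^+ 2 + beta * energy beta y z)) ->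
  (halfint (fun x => (k x * (1 + X x))%R) <= r%:E)%E ->
  (halfint (fun x => (f x ^+ 2 + beta * P x)%R) <= s%:E)%E ->
  k x0 * rho x0 <= (1 + K) * r + C * s.
Proof.
move=> x00 C0 HC hr hs; rewrite -lee_fin.
have ci := @continuous_idf R.
(* The sign is chosen so that [l] is [-1] at [x0] and [0] at [x0 + 1]; the increment of [F] is then
   exactly [k x0 * rho x0]. *)
pose l x := - (x0 + 1 - x).
have cl : continuous l.
  by apply/continuous_oppf/continuous_addf/continuous_oppf => //; exact: continuous_cstf.
have dl x : is_derive x 1 l 1.
  have := is_derive_oppf (is_derive_addf (is_derive_cstf (x0 + 1) x)
    (is_derive_oppf (is_derive_idf x))).
  by move=> /is_derive_eq; apply; rewrite add0r opprK.
pose F x := l x * k x * rho x.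
pose D x := (k x + l x * (dk x - k x * dV x)) * rho x.
have -> : k x0 * rho x0 = F (x0 + 1) - F x0.
  by rewrite /F /l; ring.
have K1 : 0 <= 1 + K by rewrite addr_ge0.
apply: (@halfint_sup D F _ _ (1 + K) C r s x0 x00 meas_ge0_kX meas_ge0_fP K1 C0 _ _ _ _ hr hs).
- apply: continuous_mulf crho; apply: continuous_addf ck _.
  apply: continuous_mulf cl _; apply: continuous_addf cdk _.
  exact: continuous_oppf (continuous_mulf ck cdV).
- exact: continuous_mulf (continuous_mulf cl ck) crho.
- move=> x x1.
  have := is_derive_mulf (is_derive_mulf (dl x) (k_derive x)) (drho x1).
  by move=> /is_derive_eq; apply; rewrite /D; ring.
- move=> x /andP[x0x xx1].
  have x1 : 0 <= x by exact: le_trans x0x.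
  apply: ler_wpM2r; first exact: ltW.
  have l1 : `|l x| <= 1 by rewrite /l ler_norml; lra.
  have h1 : l x * (dk x - k x * dV x) <= `|dk x| + k x * `|dV x|.
    apply: (le_trans (ler_norm _)); rewrite normrM.
    apply: (@le_trans _ _ (`|dk x - k x * dV x|)); first by rewrite ler_piMl.
    apply: (le_trans (ler_normB _ _)); rewrite lerD2l normrM.
    by rewrite ger0_norm.
  have h2 := HC (f x) (df x); rewrite -/(dk x) -/(P x) in h2.
  have h3 := ler_wpM2l (k_ge0 x) (dV_le x1); rewrite -/(X x) in h3.
  have h4 := mulr_ge0 (k_ge0 x) (X_ge0 x).
  by lra.
Qed.

(* The drift condition on the weight [eta + exp(- l x)] makes the derivative
   of [(F - F 0)^2 (eta + exp(- l x)) rho] dominate [(F - F 0)^2 rho]. *)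
Lemma halfint_poincare_drift (eta l s : R) : 0 < eta <= 1 -> 0 <= l ->
  (forall x, 0 <= x ->
    eta <= (eta + expR (- (l * x))) * dV x + l * expR (- (l * x))) ->
  (halfint P <= s%:E)%E ->
  (halfint (fun x => (eta / 2 * (jbracket (f x) - jbracket (f 0)) ^+ 2)%R)
    <= (8 / eta * beta * s)%:E)%E.
Proof.
move=> /andP[e0 e1] l0 drift hs.
pose G x := jbracket (f x) - jbracket (f 0).
pose dG x := f x / jbracket (f x) * df x.
pose th x := eta + expR (- (l * x)).
pose dth x := - (l * expR (- (l * x))).
have dGE x : is_derive x 1 G (dG x).
  have := is_derive_addf (is_derive_compf (f_derive x) (is_derive_jbracket (f x)))
    (is_derive_cstf (- jbracket (f 0)) x).
  by move=> /is_derive_eq; apply; rewrite addr0.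
have dthE x : is_derive x 1 th (dth x).
  have h : is_derive x 1 (fun y => - (l * y)) (- l).
    have := is_derive_oppf (is_derive_mulf (is_derive_cstf l x) (is_derive_idf x)).
    by move=> /is_derive_eq; apply; rewrite mul0r add0r mulr1.
  have := is_derive_addf (is_derive_cstf eta x)
    (is_derive_compf h (is_derive_expR (- (l * x)))).
  by move=> /is_derive_eq; apply; rewrite /dth; ring.
have cG : continuous G by exact: is_derive_continuous dGE.
have cth : continuous th by exact: is_derive_continuous dthE.
have cdG : continuous dG.
  apply: continuous_mulf cdf.
  exact: continuous_compf (@continuous_djbracket R) cf.
have cdth : continuous dth.
  apply/continuous_oppf/continuous_mulf; first exact: continuous_cstf.
  apply: continuous_compf; first exact: continuous_expR.
  apply/continuous_oppf/continuous_mulf; first exact: continuous_cstf.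
  exact: continuous_idf.
pose F x := G x * G x * th x * rho x.
pose D x := (2 * G x * dG x * th x + G x * G x * dth x
             - G x * G x * th x * dV x) * rho x.
have -> : 8 / eta * beta * s = 8 / eta * beta * s + 0 * s by rewrite mul0r addr0.
have b0 : 0 <= 8 / eta * beta.
  by rewrite mulr_ge0 ?(le_trans _ beta_ge2)// divr_ge0// ltW.
apply: (@halfint_lyapunov D F _ _ _ _ 0 s s _ _ meas_ge0_energy meas_ge0_energy b0 (lexx 0)
  _ _ _ _ _ hs hs).
- apply: continuous_mulf; first exact: continuous_cstf.
  exact: (continuous_mulf cG cG).
- by move=> x; rewrite mulr_ge0 ?sqr_ge0// divr_ge0// ltW.
- apply: continuous_mulf crho; apply: continuous_addf.
    apply: continuous_addf.
      apply: continuous_mulf cth; apply: continuous_mulf cdG.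
      exact: continuous_mulf (@continuous_cstf R 2) cG.
    exact: continuous_mulf (continuous_mulf cG cG) cdth.
  exact: continuous_oppf (continuous_mulf (continuous_mulf (continuous_mulf cG cG) cth) cdV).
- exact: continuous_mulf (continuous_mulf (continuous_mulf cG cG) cth) crho.
- move=> x x0.
  have := is_derive_mulf (is_derive_mulf
    (is_derive_mulf (dGE x) (dGE x)) (dthE x)) (drho x0).
  by move=> /is_derive_eq; apply; rewrite /D; ring.
- move=> x x0; rewrite {1}/F /G subrr !mul0r.
  apply: mulr_ge0 (ltW (rho_gt0 x)); apply: mulr_ge0.
    by rewrite -expr2 sqr_ge0.
  by rewrite addr_ge0 ?expR_ge0// ltW.
- move=> x x0; rewrite /D -mulrDl; apply: ler_wpM2r; first exact: ltW.
  rewrite mul0r addr0 -/(G x) expr2.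
  have th0 : 0 <= th x by rewrite addr_ge0 ?expR_ge0// ltW.
  have th2 : th x <= 2.
    have : expR (- (l * x)) <= 1 by rewrite -expR0 ler_expR oppr_le0 mulr_ge0.
    by rewrite /th; lra.
  have h1 : G x * G x * (eta - th x * dV x + dth x) <= 0.
    rewrite -expr2 mulr_ge0_le0 ?sqr_ge0// /th /dth.
    by have := drift x x0; lra.
  (* Expand [(eta G - 2 dG th)^2 >= 0] and use [th <= 2]; dividing by [2 eta] produces the constant
     [8 / eta]. *)
  have h2 : 2 * G x * dG x * th x <= eta / 2 * (G x * G x) + 8 / eta * dG x ^+ 2.
    have h3 : th x * th x <= 4.
      by rewrite (_ : 4 = 2 * 2 :> R) ?ler_pM//; lra.
    have h4 := sqr_ge0 (eta * G x - 2 * dG x * th x).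
    have h5 : 0 <= dG x ^+ 2 * (4 - th x * th x).
      by rewrite mulr_ge0 ?sqr_ge0// subr_ge0.
    rewrite -(ler_pM2l e0) [leRHS]mulrDr.
    have -> : eta * (8 / eta * dG x ^+ 2) = 8 * dG x ^+ 2.
      by field; rewrite gt_eqF.
    by move: h4 h5; rewrite !expr2; lra.
  have h6 : 8 / eta * dG x ^+ 2 <= 8 / eta * beta * P x.
    rewrite -[leRHS]mulrA ler_wpM2l ?divr_ge0 ?(ltW e0)//.
    exact: djbracket_sqr_le_energy.
  by lra.
Qed.

End one_function.

Let X_powR x : 0 <= x -> X x = x `^ (p + 1).
Proof.
move=> x0; rewrite /X ger0_norm// -[in LHS](addrK 1 p) mulr_powRB1//.
by rewrite addr_gt0.
Qed.

Lemma halfint_poincare : weighted_poincare V beta.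
Proof.
have b1 : 0 <= beta - 1 by rewrite subr_ge0 (le_trans _ beta_ge2)// ler1n.
(* [r0] solves [c r0^p = M + 1], so [dV >= 1] beyond it. With [l = M + 1] and [E] the least value of
   [exp(- l x)] on [[0, r0]], [eta] is fixed by [2 l eta = E]. *)
pose r0 := ((M + 1) / c) `^ (beta - 1).
pose l := M + 1.
have l0 : 0 < l by rewrite ltr_wpDl.
have r00 : 0 <= r0 by exact: powR_ge0.
pose E := expR (- (l * r0)).
have E0 : 0 < E by exact: expR_gt0.
have E1 : E <= 1 by rewrite -expR0 ler_expR oppr_le0 mulr_ge0// ltW.
pose eta := E / (2 * l).
have eta0 : 0 < eta by rewrite divr_gt0// mulr_gt0.
have leta : 2 * l * eta = E by rewrite /eta mulrC divfK// gt_eqF// mulr_gt0.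
have eta1 : 0 < eta <= 1.
  rewrite eta0 /eta ler_pdivrMr ?mulr_gt0// mul1r (le_trans E1)//.
  by have := M_ge0; rewrite /l; lra.
have drift x : 0 <= x ->
    eta <= (eta + expR (- (l * x))) * dV x + l * expR (- (l * x)).
  move=> x0; set e := expR _.
  have e0 : 0 < e by exact: expR_gt0.
  have hdV := dV_ge x0.
  (* On [[0, r0]] the term [l e] outweighs [- M (eta + e)] and leaves
     [e - M eta >= E - M eta >= eta]. Beyond [r0], [dV >= 1] is enough. *)
  have [xr|/ltW xr] := leP x r0.
    have Ee : E <= e by rewrite ler_expR lerN2 ler_wpM2l// ltW.
    have h0 : - M <= dV x.
      by apply: le_trans hdV; rewrite lerBrDr addNr mulr_ge0 ?powR_ge0// ltW.
    have h1 : (eta + e) * - M <= (eta + e) * dV x.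
      by rewrite ler_wpM2l// addr_ge0// ltW.
    have leta' : 2 * (M + 1) * eta = E := leta.
    have Meta : 0 <= M * eta by rewrite mulr_ge0// ltW.
    by rewrite /l; lra.
  have h0 : 1 <= dV x.
    apply: le_trans hdV; rewrite lerBrDr addrC -ler_pdivrMl// mulrC.
    rewrite (_ : (M + 1) / c = r0 `^ p); last first.
      rewrite /r0 -powRrM (mulrC _ p) pbeta powRr1// divr_ge0//; last exact: ltW.
      by rewrite addr_ge0.
    by rewrite ger0_norm//; apply: ge0_ler_powR; rewrite ?nnegrE// ltW.
  have h1 : (eta + e) * 1 <= (eta + e) * dV x.
    by rewrite ler_wpM2l// addr_ge0// ltW.
  have h2 : 0 <= l * e by rewrite mulr_ge0// ltW.
  by lra.
exists (2 / eta * (8 / eta * beta)).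
  have b0 : 0 <= beta by exact: le_trans beta_ge2.
  have e0 (n : R) : 0 <= n -> 0 <= n / eta by move=> n0; rewrite divr_ge0// ltW.
  by rewrite mulr_ge0 ?e0// mulr_ge0 ?e0.
move=> f df fdf cdf s hs.
have := halfint_poincare_drift fdf cdf eta1 (ltW l0) drift hs.
have cf : continuous f by exact: is_derive_continuous fdf.
have cG : continuous (fun x => jbracket (f x) - jbracket (f 0)).
  apply: continuous_addf; last exact: continuous_cstf.
  exact: continuous_compf (@continuous_jbracket R) cf.
have cG2 : continuous (fun x => (jbracket (f x) - jbracket (f 0)) ^+ 2).
  exact: (continuous_mulf cG cG).
have m1 : meas_ge0 (fun x => (jbracket (f x) - jbracket (f 0)) ^+ 2).
  by apply: meas_ge0_continuous => // x; rewrite sqr_ge0.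
have m2 : meas_ge0 (fun x => eta / 2 * (jbracket (f x) - jbracket (f 0)) ^+ 2).
  apply: meas_ge0_continuous.
    exact: continuous_mulf (@continuous_cstf R _) cG2.
  by move=> x; rewrite mulr_ge0 ?sqr_ge0// divr_ge0// ltW.
move=> h.
have e2 : 0 <= 2 / eta by rewrite divr_ge0// ltW.
apply: (le_trans (halfint_lin m1 m2 m2 e2 (lexx 0) _ h h)).
  move=> x x0; rewrite mul0r addr0.
  by rewrite le_eqVlt; apply/orP; left; apply/eqP; field; rewrite gt_eqF.
by rewrite mul0r addr0 lee_fin !mulrA.
Qed.

Lemma halfint_entropy : weighted_entropy V beta.
Proof.
move=> L L0.
have b0 : 0 <= beta by exact: le_trans beta_ge2.
(* Superlinearity of [X] absorbs the defect [M x] of the drift at the price of a quarter of [c]. *)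
have [C1 C10 H1] : exists2 C1 : R, 0 <= C1 &
    forall x, 0 <= x -> M * x <= c / 4 * X x + C1.
  have c4 : 0 <= 4 * M / c by rewrite divr_ge0 ?mulr_ge0// ltW.
  have p1 : 1 < p + 1 by rewrite ltrDr.
  have [K' HK'] := @powR_superlinear R (p + 1) (4 * M / c) p1 c4.
  have cc4 : 0 <= c / 4 by rewrite divr_ge0// ltW.
  exists (c / 4 * `|K'|); first by rewrite mulr_ge0.
  move=> x x0; rewrite X_powR// -mulrDr.
  have : 4 * M / c * x <= x `^ (p + 1) + `|K'|.
    have := HK' _ x0; have := ler_norm K'; lra.
  move=> /(ler_wpM2l cc4); apply: le_trans.
  by rewrite le_eqVlt; apply/orP; left; apply/eqP; field; rewrite gt_eqF.
have [C2 C20 H2] := dtrunc_sq_young beta_ge2 pbeta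
  (divr_gt0 c_gt0 (ltr0Sn R 3)) beta_le.
pose cd : R := 2 * (1 + 2 * m.+1.*2%:R).
have cd0 : 0 <= cd by rewrite mulr_ge0// addr_ge0// mulr_ge0.
pose a := 1 + 2 / c * (1 + C1 + C2).
have c2 : 0 <= 2 / c by rewrite divr_ge0// ltW.
have a0 : 0 <= a by rewrite addr_ge0// mulr_ge0// !addr_ge0.
pose C3 : R := 3 ^+ m.+1.*2.
have C30 : 0 <= C3 by rewrite exprn_ge0.
pose L3 : R := ln C3.
have L30 : 0 <= L3 by rewrite ln_ge0// exprn_ege1// ler1n.
have K1 : 0 <= 1 + K by rewrite addr_ge0.
pose C := 3 + C3 * (L3 + (1 + K) * (a * L) + cd * L + cd * (beta * L)) + C3 * (K * a).
exists C.
  by rewrite /C; nonneg.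
move=> f df fdf cdf r s /andP[r0 rL] s0 hL hr hs.
have cf : continuous f by exact: is_derive_continuous fdf.
have cf2 : continuous (fun x => f x ^+ 2) by exact: continuous_mulf.
pose k x := trunc_sq m (f x).
have k0 x : 0 <= k x by exact: trunc_sq_ge0.
have ck : continuous k by exact: continuous_compf (@continuous_trunc_sq R m) cf.
have mk : meas_ge0 k by exact: meas_ge0_continuous.
have mQ : meas_ge0 (fun x => fluct (f x)).
  apply: meas_ge0_continuous; first exact: continuous_compf (@continuous_fluct R) cf.
  by move=> x; exact: fluct_ge0.
have mP := meas_ge0_energy fdf cdf.
have mkX : meas_ge0 (fun x => k x * (1 + X x)).
  apply: meas_ge0_continuous.
    exact: continuous_mulf ck (continuous_addf (@continuous_cstf R 1) cX).
  by move=> x; rewrite mulr_ge0// addr_ge0.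
have hk : (halfint k <= r%:E)%E.
  have := halfint_lin mk mQ mQ (@ler01 R) (lexx 0) _ hr hr.
  rewrite mul0r addr0 mul1r; apply => x _.
  by rewrite mul1r mul0r addr0 trunc_sq_le_fluct.
have h1 := halfint_moment fdf cdf C10 C20 H1 H2 hk hs.
(* The first [r] accounts for [k], the rest for [k X]: the factor [2 / c] undoes the [c / 2] of
   [halfint_moment]. The constant [a] was chosen to give [A <= a * (r + s)]. *)
pose A := r + 2 / c * ((1 + C1) * r + C2 * s).
have hA : (halfint (fun x => (k x * (1 + X x))%R) <= A%:E)%E.
  have m2 : meas_ge0 (fun x => c / 2 * (k x * X x)).
    apply: meas_ge0_continuous.
      exact: continuous_mulf (@continuous_cstf R _) (continuous_mulf ck cX).
    move=> x; apply: mulr_ge0; first by rewrite divr_ge0// ltW.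
    exact: mulr_ge0.
  have := halfint_lin mkX mk m2 (@ler01 R) c2 _ hk h1.
  rewrite mul1r; apply => x _.
  rewrite mul1r mulrDr mulr1 lerD2l.
  by rewrite le_eqVlt; apply/orP; left; apply/eqP; field; rewrite gt_eqF.
have A0 : 0 <= A by rewrite ?/A ?/S; nonneg.
have Aa : A <= a * (r + s).
  have h3 : 0 <= 2 / c * (C1 * s + s + C2 * r) by rewrite ?/A ?/S; nonneg.
  by rewrite /A /a; lra.
have mfP : meas_ge0 (fun x => f x ^+ 2 + beta * energy beta (f x) (df x)).
  case: mP => [mP P0]; split.
    by apply: measurable_funD; [exact: continuous_measurable_fun|exact: measurable_funM].
  by move=> x; rewrite addr_ge0 ?sqr_ge0// mulr_ge0.
have m1f : meas_ge0 (fun x => 1 + f x ^+ 2).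
  apply: meas_ge0_continuous; last by move=> x; rewrite addr_ge0 ?sqr_ge0.
  exact: continuous_addf (@continuous_cstf R 1) cf2.
have h3 : (halfint (fun x => (f x ^+ 2 + beta * energy beta (f x) (df x))%R)
    <= (L + beta * s)%:E)%E.
  have := halfint_lin mfP m1f mP (@ler01 R) b0 _ hL hs.
  by rewrite mul1r; apply => x _; rewrite mul1r lerD2r lerDr.
(* The pointwise bound on [k x * rho x] provided by [halfint_sup_trunc]. *)
pose S := (1 + K) * A + cd * (L + beta * s).
have S0 : 0 <= S by rewrite ?/A ?/S; nonneg.
have hS x : 0 <= x -> k x * rho x <= S.
  move=> x0; apply: (halfint_sup_trunc fdf cdf x0 cd0 _ hA h3).
  by move=> y z; exact: (dtrunc_sq_le_energy beta_ge2).
have LS : 0 <= C3 * (L3 + S) by rewrite mulr_ge0// addr_ge0.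
have CK : 0 <= C3 * K by rewrite mulr_ge0.
(* The second term of [ent_le_trunc] with [W = K (1 + X)], split into multiples of [k] and of
   [k (1 + X)], both already integrated. *)
have m3 : meas_ge0 (fun x => C3 * (L3 + S) * k x + C3 * K * (k x * (1 + X x))).
  apply: meas_ge0_continuous.
    apply: continuous_addf.
      exact: continuous_mulf (@continuous_cstf R _) ck.
    apply: continuous_mulf (@continuous_cstf R _) _.
    exact: continuous_mulf ck (continuous_addf (@continuous_cstf R 1) cX).
  move=> x; apply: addr_ge0; first exact: mulr_ge0.
  by apply: mulr_ge0 CK _; case: mkX.
have h4 := halfint_lin m3 mk mkX LS CK (fun _ _ => lexx _) hk hA.
have ment : meas_ge0 (fun x => ent (f x ^+ 2)).
  split; last by move=> x; rewrite ent_ge0// sqr_ge0.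
  have mf2 : measurable_fun [set: R] (fun x => f x ^+ 2).
    exact: continuous_measurable_fun.
  apply: measurable_funD => //; apply: measurable_funB => //.
  apply: measurable_funM => //; exact: measurableT_comp.
have := halfint_lin ment mQ m3 (ler0n R 3) (@ler01 R) _ hr h4.
move=> /(_ _)/le_trans; apply.
  move=> x x0.
  apply: (le_trans (ent_le_trunc S0 (V_le x0) _ (hS x x0))).
    by rewrite mulr_ge0// addr_ge0.
  rewrite -/(X x) -/(k x) -/C3 -/L3 lerD2l.
  by rewrite le_eqVlt; apply/orP; left; apply/eqP; ring.
rewrite lee_fin mul1r.
(* The products [A r] and [s r] are quadratic in [r] and [s]; [r <= L] makes them linear. *)
have rs : A * r <= a * L * (r + s).
  apply: (@le_trans _ _ (a * (r + s) * r)); first by rewrite ler_wpM2r.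
  by rewrite mulrAC ler_wpM2r ?addr_ge0// ler_wpM2l.
have sr : s * r <= L * (r + s).
  by have := mulr_ge0 L0 r0; have := ler_wpM2l s0 rL; lra.
have e1 : C3 * L3 * r <= C3 * L3 * (r + s).
  by rewrite ler_wpM2l ?lerDl//; nonneg.
have e2 : C3 * (1 + K) * (A * r) <= C3 * (1 + K) * (a * L * (r + s)).
  by rewrite ler_wpM2l//; nonneg.
have e3 : C3 * cd * L * r <= C3 * cd * L * (r + s).
  by rewrite ler_wpM2l ?lerDl//; nonneg.
have e4 : C3 * cd * beta * (s * r) <= C3 * cd * beta * (L * (r + s)).
  by rewrite ler_wpM2l//; nonneg.
have e5 : C3 * K * A <= C3 * K * (a * (r + s)) by rewrite ler_wpM2l.
by rewrite /S /C; lra.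
Qed.

End halfline.

(** * From half-lines to the measure *)

Section centering.
Context {R : realType}.
Implicit Types (phi psi : R -> R).

Variable mu : probability (measurableTypeR R) R.

Lemma meas_ge0_integral_le phi psi (a r : R) : meas_ge0 phi -> meas_ge0 psi -> 0 <= a ->
  (forall x, phi x <= a * psi x) -> (\int[mu]_x (psi x)%:E <= r%:E)%E ->
  (\int[mu]_x (phi x)%:E <= (a * r)%:E)%E.
Proof.
move=> [mphi phi0] [mpsi psi0] a0 le_phi hr.
apply: (@le_trans _ _ (\int[mu]_x (a%:E * (psi x)%:E))%E).
  apply: ge0_le_integral => //.
  - by move=> x _; rewrite lee_fin.
  - exact/measurable_EFinP.
  - by apply: measurable_funeM; exact/measurable_EFinP.
  - by move=> x _; rewrite -EFinM lee_fin.
rewrite ge0_integralZl_EFin//; last 2 first.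
- by move=> x _; rewrite lee_fin.
- exact/measurable_EFinP.
by rewrite EFinM lee_wpmul2l.
Qed.

(* With [m] the mean of [f], [int (f - t)^2 = 4 - 2 t m <= 4 - 2 m^2], which is
   twice the variance of [f], and the variance is at most [int (f - c)^2]. *)
Lemma centering_le (f : R -> R) (t c : R) : continuous f ->
  (forall x, 1 <= f x) -> (\int[mu]_x (f x ^+ 2)%:E = 2%:E)%E ->
  0 < t -> t ^+ 2 = 2 ->
  (\int[mu]_x ((f x - t) ^+ 2)%:E <= 2%:E * \int[mu]_x ((f x - c) ^+ 2)%:E)%E.
Proof.
move=> cf f1 f2 t0 t2.
have mf : measurable_fun [set: R] f by exact: continuous_measurable_fun.
have mf2 : measurable_fun [set: R] (fun x => f x ^+ 2) by exact: measurable_funX.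
have if2 : mu.-integrable setT (EFin \o (fun x => f x ^+ 2)).
  apply/integrableP; split; first exact/measurable_EFinP.
  under eq_integral do rewrite gee0_abs ?lee_fin ?sqr_ge0//.
  by rewrite f2 ltry.
have if1 : mu.-integrable setT (EFin \o f).
  apply: le_integrable if2 => //; first exact/measurable_EFinP.
  move=> x _; rewrite /= lee_fin ger0_norm ?(le_trans _ (f1 x))//.
  by rewrite ger0_norm ?sqr_ge0// expr2 ler_peMl// (le_trans _ (f1 x)).
have ic (d : R) : mu.-integrable setT (EFin \o (fun=> d)).
  exact: finite_measure_integrable_cst.
pose m := fine (\int[mu]_x (f x)%:E)%E.
have mE : (\int[mu]_x (f x)%:E = m%:E)%E.
  by rewrite fineK//; exact: integrable_fin_num.
have quad (b d : R) :
    (\int[mu]_x (f x ^+ 2 + (b * f x + d))%:E = (2 + (b * m + d))%:E)%E.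
  have ib : mu.-integrable setT (fun x => b%:E * (f x)%:E)%E.
    exact: integrableZl.
  have ibd : mu.-integrable setT (fun x => b%:E * (f x)%:E + d%:E)%E.
    exact: (integrableD measurableT ib (ic d)).
  under eq_integral do rewrite EFinD EFinD EFinM.
  rewrite (integralD measurableT if2 ibd) f2 (integralD measurableT ib (ic d)).
  rewrite (integralZl measurableT if1) mE.
  by rewrite integral_cst//= probability_setT mule1 -EFinM -!EFinD.
have sq (d : R) : (\int[mu]_x ((f x - d) ^+ 2)%:E =
    (2 + (- (2 * d) * m + d ^+ 2))%:E)%E.
  rewrite -quad; apply: eq_integral => x _; congr (_%:E); ring.
rewrite !sq -EFinM lee_fin t2.
have m0 : 0 <= m.
  by rewrite -lee_fin -mE; apply: integral_ge0 => x _; rewrite lee_fin (le_trans _ (f1 x)).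
(* Nonnegativity of [int (f - t)^2 = 4 - 2 t m] reads [t m <= t^2]. *)
have mt : m <= t.
  have : (0%:E <= \int[mu]_x ((f x - t) ^+ 2)%:E)%E.
    by apply: integral_ge0 => x _; rewrite lee_fin sqr_ge0.
  rewrite sq t2 lee_fin => h; rewrite -(ler_pM2l t0).
  by rewrite expr2 in t2; lra.
have h1 := sqr_ge0 (c - m).
have h2 : 0 <= m * (t - m) by rewrite mulr_ge0// subr_ge0.
by move: h1 h2; rewrite !expr2; lra.
Qed.

End centering.

(** * Gluing the half-line inequalities *)

Section two_sided.
Context {R : realType}.
Implicit Types (phi f df V : R -> R) (x r : R) (b : bool).

Definition side b phi x := phi (if b then - x else x).

(* [two = true] for a measure on the line, [two = false] for one on the
   half-line. *)
Variables (mu : probability (measurableTypeR R) R) (V : R -> R) (beta : R).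
Variables (two : bool) (k1 k2 : R).
Hypotheses (beta_ge2 : 2 <= beta) (k1_ge0 : 0 <= k1) (k2_ge0 : 0 <= k2).
Hypothesis halfint_le_mu : forall phi r b, meas_ge0 phi -> (b -> two) ->
  (\int[mu]_x (phi x)%:E <= r%:E)%E ->
  (halfint V (side b phi) <= (k1 * r)%:E)%E.
Hypothesis mu_le_halfint : forall phi r, meas_ge0 phi -> 0 <= r ->
  (forall b, (b -> two) -> (halfint V (side b phi) <= r%:E)%E) ->
  (\int[mu]_x (phi x)%:E <= (k2 * r)%:E)%E.
Hypotheses (poincareV : weighted_poincare V beta)
           (entropyV : weighted_entropy V beta).

(** Both sides share the centre [F 0], so their Poincare inequalities add up to one for [mu].
    Recentring at [sqrt 2] then bounds the integral of [fluct], the input of the entropy estimate on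
    each side. *)
Lemma ent_le_energy : exists2 C : R, 0 <= C & forall f df,
  (forall x, is_derive x 1 f (df x)) -> continuous df ->
  (\int[mu]_x (f x ^+ 2)%:E = 1)%E ->
  forall r, (\int[mu]_x (energy beta (f x) (df x))%:E <= r%:E)%E ->
  (\int[mu]_x (ent (f x ^+ 2))%:E <= (C * r)%:E)%E.
Proof.
have [Cp Cp0 HCp] := poincareV.
have L0 : 0 <= k1 * 2 by rewrite mulr_ge0.
have [Ce Ce0 HCe] := entropyV L0.
(* [9] bounds [((F + t) / F)^2], [2] is the loss in [centering_le], and the rest carries the
   Poincare constant from the half-lines to [mu]. *)
pose D := 9 * (2 * (k2 * (Cp * k1))).
have D0 : 0 <= D by rewrite /D; nonneg.
exists (k2 * (Ce * (k1 * D + k1))); first by nonneg.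
move=> f df fdf cdf f1 r hr.
have cf : continuous f by exact: is_derive_continuous fdf.
have cf2 : continuous (fun x => f x ^+ 2) by exact: continuous_mulf.
have mP : meas_ge0 (fun x => energy beta (f x) (df x)).
  by split; [exact: measurable_energy|move=> x; exact: energy_ge0].
have r0 : 0 <= r.
  rewrite -lee_fin; apply: le_trans hr.
  by apply: integral_ge0 => x _; rewrite lee_fin; case: mP.
pose fb b x := f (if b then - x else x).
pose dfb b x := (if b then -1 else 1) * df (if b then - x else x).
have fbE b x : is_derive x 1 (fb b) (dfb b x).
  rewrite /fb /dfb; case: b; last by rewrite mul1r; exact: fdf.
  have := is_derive_compf (is_derive_oppf (is_derive_idf x)) (fdf (- x)).
  by move=> /is_derive_eq; apply; rewrite mulrC.
have cdfb b : continuous (dfb b).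
  rewrite /dfb; apply: continuous_mulf; first exact: continuous_cstf.
  case: b => //; apply: continuous_compf => //.
  exact: continuous_oppf (@continuous_idf R).
have hP b : (b -> two) ->
    (halfint V (fun x => energy beta (fb b x) (dfb b x)) <= (k1 * r)%:E)%E.
  move=> /(halfint_le_mu mP)/(_ hr); apply: le_trans.
  rewrite le_eqVlt; apply/orP; left; apply/eqP; congr (halfint V _).
  apply/funext => x; rewrite /fb /dfb /side; case: b; last by rewrite mul1r.
  by rewrite mulN1r energyN.
have m1 : meas_ge0 (fun x => 1 + f x ^+ 2).
  apply: meas_ge0_continuous; last by move=> x; rewrite addr_ge0 ?sqr_ge0.
  exact: continuous_addf (@continuous_cstf R 1) cf2.
have mu2 : (\int[mu]_x (1 + f x ^+ 2)%:E = 2%:E)%E.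
  under eq_integral do rewrite EFinD.
  rewrite ge0_integralD//=; last 2 first.
  - by move=> x _; rewrite lee_fin sqr_ge0.
  - by apply/measurable_EFinP; exact: continuous_measurable_fun.
  by rewrite f1 integral_cst//= probability_setT mule1 -EFinD.
have half1 b : (b -> two) -> (halfint V (fun x => (1 + fb b x ^+ 2)%R) <= (k1 * 2)%:E)%E.
  by move=> bt; apply: (halfint_le_mu m1 bt); rewrite mu2.
pose F x := jbracket (f x).
have cF : continuous F by exact: continuous_compf (@continuous_jbracket R) cf.
have mF2 (d : R) : meas_ge0 (fun x => (F x - d) ^+ 2).
  apply: meas_ge0_continuous; last by move=> x; rewrite sqr_ge0.
  have cFd := continuous_addf cF (@continuous_cstf R (- d)).
  exact: (continuous_mulf cFd cFd).
have hF : (\int[mu]_x ((F x - F 0) ^+ 2)%:E <= (k2 * (Cp * k1) * r)%:E)%E.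
  rewrite -mulrA; apply: mu_le_halfint => //; first by rewrite !mulr_ge0.
  move=> b bt; have := HCp _ _ (fbE b) (cdfb b) _ (hP b bt).
  rewrite mulrA; apply: le_trans.
  rewrite le_eqVlt; apply/orP; left; apply/eqP; congr (halfint V _).
  apply/funext => x; rewrite /side /F /fb.
  by have -> : (if b then - 0 else 0) = 0 :> R by rewrite oppr0 if_same.
(* [t] is the norm of [F] in [L^2(mu)], since [1 + f^2] has integral [2]. *)
pose t : R := Num.sqrt 2.
have t0 : 0 < t by rewrite sqrtr_gt0.
have t2 : t ^+ 2 = 2 by rewrite sqr_sqrtr.
have F1 x : 1 <= F x.
  by rewrite -[leLHS]sqrtr1 ler_wsqrtr// lerDl sqr_ge0.
have hFt : (\int[mu]_x ((F x - t) ^+ 2)%:E <= (2 * (k2 * (Cp * k1) * r))%:E)%E.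
  have F2 : (\int[mu]_x (F x ^+ 2)%:E = 2%:E)%E.
    by under eq_integral do rewrite jbracket_sqr.
  apply: (le_trans (centering_le (F 0) cF F1 F2 t0 t2)).
  by rewrite [leRHS]EFinM lee_wpmul2l.
have mQ : meas_ge0 (fun x => fluct (f x)).
  apply: meas_ge0_continuous; first exact: continuous_compf (@continuous_fluct R) cf.
  by move=> x; exact: fluct_ge0.
have hQ : (\int[mu]_x (fluct (f x))%:E <= (D * r)%:E)%E.
  have -> : D * r = 9 * (2 * (k2 * (Cp * k1) * r)) by rewrite /D; ring.
  apply: meas_ge0_integral_le (mF2 t) _ _ hFt => // x.
  have Fp : 0 < F x by exact: jbracket_gt0.
  have Fx2 : F x ^+ 2 = 1 + f x ^+ 2 by exact: jbracket_sqr.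
  have -> : fluct (f x) = ((F x + t) / F x) ^+ 2 * (F x - t) ^+ 2.
    rewrite /fluct /contrast.
    have -> : f x ^+ 2 = F x ^+ 2 - 1 by rewrite Fx2; ring.
    have -> : F x ^+ 2 - 1 - 1 = (F x + t) * (F x - t).
      by move: t2; rewrite !expr2 => t2; lra.
    have Fn0 : F x != 0 by rewrite gt_eqF.
    by field; rewrite Fn0 subrK sqrf_eq0 Fn0.
  rewrite ler_wpM2r ?sqr_ge0//.
  have h0 : 0 <= (F x + t) / F x by rewrite divr_ge0 ?addr_ge0// ltW.
  have h3 : (F x + t) / F x <= 3.
    have t3 : t <= 2.
      rewrite leNgt; apply/negP => t3.
      have : 2 * 2 < t * t by rewrite ltr_pM.
      by move: t2; rewrite expr2; lra.
    by rewrite ler_pdivrMr//; have := F1 x; lra.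
  by rewrite expr2 (_ : 9 = 3 * 3 :> R) ?ler_pM//; lra.
have ment : meas_ge0 (fun x => ent (f x ^+ 2)).
  split; last by move=> x; rewrite ent_ge0// sqr_ge0.
  have mf2 : measurable_fun [set: R] (fun x => f x ^+ 2).
    exact: continuous_measurable_fun.
  apply: measurable_funD => //; apply: measurable_funB => //.
  by apply: measurable_funM => //; exact: measurableT_comp.
(* [weighted_entropy] requires a bound on the integral of [fluct] not exceeding [L = k1 * 2]; the
   minimum meets it and stays linear in [r]. *)
pose q := Num.min (k1 * (D * r)) (k1 * 2).
have q0 : 0 <= q by rewrite le_min !mulr_ge0.
have qE : q <= k1 * (D * r) by rewrite ge_min lexx.
have -> : k2 * (Ce * (k1 * D + k1)) * r = k2 * (Ce * (k1 * (D * r) + k1 * r)).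
  by ring.
apply: mu_le_halfint => //; first by nonneg.
move=> b bt.
have qL : 0 <= q <= k1 * 2 by rewrite q0 ge_min lexx orbT.
have hQb : (halfint V (fun x => fluct (fb b x)) <= q%:E)%E.
  have h1 := halfint_le_mu mQ bt hQ.
  have h2 : (halfint V (fun x => fluct (fb b x)) <= (k1 * 2)%:E)%E.
    apply: (halfint_le_mu mQ bt); rewrite -(mul1r 2).
    apply: (meas_ge0_integral_le mQ m1) => //; last by rewrite mu2.
    by move=> x; rewrite mul1r fluct_le.
  by rewrite /q; case: (leP (k1 * (D * r)) (k1 * 2)).
have := HCe _ _ (fbE b) (cdfb b) _ _ qL (mulr_ge0 k1_ge0 r0) (half1 b bt) hQb (hP b bt).
move=> /le_trans; apply.
by rewrite lee_fin ler_wpM2l// lerD2r.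
Qed.

End two_sided.

(** * Normalization and the passage to [LSI] *)

Section lsi.
Context {R : realType}.
Variables (mu : probability (measurableTypeR R) R) (beta C : R).
Hypotheses (beta_ge2 : 2 <= beta) (C_ge0 : 0 <= C).

Lemma LSI_of_ent_le_energy :
  (forall f df : R -> R,
    (forall x : R, is_derive x 1 f (df x)) -> continuous df ->
    (\int[mu]_x (f x ^+ 2)%:E = 1)%E ->
    forall r : R, (\int[mu]_x (energy beta (f x) (df x))%:E <= r%:E)%E ->
    (\int[mu]_x (ent (f x ^+ 2))%:E <= (C * r)%:E)%E) ->
  LSI mu 1 beta (C + 1).
Proof.
move=> H f sf fL2; pose df := derive1 f.
have fdf (x : R) : is_derive x 1 f (df x).
  have := sf 0%N x; rewrite derive1n0 => dfx.
  by apply: DeriveDef => //; rewrite /df derive1E.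
have cdf : continuous df.
  move=> x; have := sf 1%N x; rewrite derive1n1 => dfx.
  exact/differentiable_continuous/derivable1_diffP.
have cf : continuous f by exact: is_derive_continuous fdf.
have mf2 : measurable_fun [set: R] (fun x => f x ^+ 2).
  by apply: continuous_measurable_fun; exact: (continuous_mulf cf cf).
have if2 : mu.-integrable setT (EFin \o (fun x => f x ^+ 2)).
  exact: Lfun2_integrable_sqr.
pose m := fine (\int[mu]_x (f x ^+ 2)%:E)%E.
have mE : (\int[mu]_x (f x ^+ 2)%:E = m%:E)%E.
  by rewrite fineK//; exact: integrable_fin_num.
have m_ge0 : 0 <= m.
  by rewrite -lee_fin -mE; apply: integral_ge0 => x _; rewrite lee_fin sqr_ge0.
have mP : meas_ge0 (fun x => energy beta (f x) (df x)).
  by split; [exact: measurable_energy|move=> x; exact: energy_ge0].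
have C1 : 0 <= C + 1 by rewrite addr_ge0.
rewrite /entropy -/m.
(* At a zero of [f] the product [+oo * 0] is [0], the value that [energy] takes there. *)
have -> : (\int[mu]_x (Hfun_ext 1 beta (quot_ext (derive1 f x) (f x)) *
    ((f x ^+ 2)%R)%:E) = \int[mu]_x (energy beta (f x) (df x))%:E)%E.
  apply: eq_integral => x _; rewrite /quot_ext /energy.
  by case: eqP => [->|_]; [rewrite expr0n/= mule0|rewrite /= -EFinM].
have P0 : (0 <= \int[mu]_x (energy beta (f x) (df x))%:E)%E.
  by apply: integral_ge0 => x _; rewrite lee_fin; case: mP.
(* If [f^2] has integral [0], the defaults [x / 0 = 0] and [ln 0 = 0] make the entropy integrand
   vanish. *)
have [m0|m0] := eqVneq m 0.
  rewrite (_ : (\int[mu]_x _ = 0)%E) ?mule_ge0//.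
  rewrite -(integral0 mu setT); apply: eq_integral => x _.
  by rewrite m0 invr0 mulr0 ln0// mulr0.
have m_gt0 : 0 < m by rewrite lt_neqAle eq_sym m0.
(* For infinite energy the constant must be positive: with [C = 0] the right side would be
   [0 * +oo = 0], hence the choice of [C + 1]. *)
case: (boolP (\int[mu]_x (energy beta (f x) (df x))%:E < +oo)%E); last first.
  rewrite -leNgt leye_eq => /eqP ->; rewrite gt0_muley ?leey//.
  by rewrite lte_fin ltr_wpDl.
move=> Poo; pose r := fine (\int[mu]_x (energy beta (f x) (df x))%:E)%E.
have rE : (\int[mu]_x (energy beta (f x) (df x))%:E = r%:E)%E.
  by rewrite fineK// ge0_fin_numE.
have r0 : 0 <= r by rewrite -lee_fin -rE.
pose s := (Num.sqrt m)^-1.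
have s0 : s != 0 by rewrite invr_eq0 gt_eqF// sqrtr_gt0.
have s2 : s ^+ 2 = m^-1 by rewrite exprVn sqr_sqrtr.
pose h x := s * f x; pose dh x := s * df x.
have hdh (x : R) : is_derive x 1 h (dh x).
  have := is_derive_mulf (is_derive_cstf s x) (fdf x).
  by move=> /is_derive_eq; apply; rewrite mul0r add0r.
have cdh : continuous dh by exact: continuous_mulf (@continuous_cstf R s) cdf.
have h2 (x : R) : h x ^+ 2 = m^-1 * f x ^+ 2 by rewrite exprMn s2.
have half1 : (\int[mu]_x (h x ^+ 2)%:E = 1)%E.
  under eq_integral do rewrite h2 EFinM.
  rewrite ge0_integralZl_EFin ?invr_ge0//=.
  - by rewrite mE -EFinM mulVf.
  - by move=> x _; rewrite lee_fin sqr_ge0.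
  - exact/measurable_EFinP.
have hP : (\int[mu]_x (energy beta (h x) (dh x))%:E <= (m^-1 * r)%:E)%E.
  under eq_integral do rewrite energyZ// s2 EFinM.
  rewrite ge0_integralZl_EFin ?invr_ge0//=.
  - by rewrite rE -EFinM.
  - by move=> x _; rewrite lee_fin; exact: energy_ge0.
  - by apply/measurable_EFinP; case: mP.
have := H h dh hdh cdh half1 _ hP; set I := (\int[mu]_x _)%E => hI.
have ch : continuous h by exact: is_derive_continuous hdh.
have mh2 : measurable_fun [set: R] (fun x => h x ^+ 2).
  by apply: continuous_measurable_fun; exact: (continuous_mulf ch ch).
have ment : measurable_fun [set: R] (fun x => ent (h x ^+ 2)).
  apply: measurable_funD => //; apply: measurable_funB => //.
  by apply: measurable_funM => //; exact: measurableT_comp.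
have ent0 (x : R) : (0 <= (ent (h x ^+ 2))%:E)%E by rewrite lee_fin ent_ge0// sqr_ge0.
have I0 : (0 <= I)%E by apply: integral_ge0.
have ient : mu.-integrable setT (EFin \o (fun x => ent (h x ^+ 2))).
  apply/integrableP; split; first exact/measurable_EFinP.
  under eq_integral do rewrite gee0_abs ?lee_fin ?ent_ge0 ?sqr_ge0//.
  exact: le_lt_trans hI (ltry _).
have ih2 : mu.-integrable setT (EFin \o (fun x => h x ^+ 2)).
  apply/integrableP; split; first exact/measurable_EFinP.
  under eq_integral do rewrite gee0_abs ?lee_fin ?sqr_ge0//.
  by rewrite half1 ltry.
have ic : mu.-integrable setT (EFin \o (fun=> (-1) : R)).
  exact: finite_measure_integrable_cst.
have ih1 : mu.-integrable setT (fun x => (h x ^+ 2)%:E + (-1)%:E)%E.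
  exact: (integrableD measurableT ih2 ic).
have isum : mu.-integrable setT
    (fun x => (ent (h x ^+ 2))%:E + ((h x ^+ 2)%:E + (-1)%:E))%E.
  exact: (integrableD measurableT ient ih1).
(* With [f^2 = m h^2], the integrands differ by a multiple of [h^2 - 1], whose integral is [0]. *)
have -> : (\int[mu]_x (f x ^+ 2 * ln (f x ^+ 2 / m))%:E = m%:E * I)%E.
  transitivity (\int[mu]_x
      (m%:E * ((ent (h x ^+ 2))%:E + ((h x ^+ 2)%:E + (-1)%:E))))%E.
    apply: eq_integral => x _.
    rewrite -!EFinD -EFinM; congr (_%:E).
    rewrite /ent (_ : f x ^+ 2 / m = h x ^+ 2); last by rewrite h2 mulrC.
    rewrite (_ : f x ^+ 2 = m * h x ^+ 2); last by rewrite h2 mulrA mulfV ?mul1r.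
    by ring.
  rewrite (integralZl measurableT isum); congr (_ * _)%E.
  rewrite (integralD measurableT ient ih1) (integralD measurableT ih2 ic) half1.
  by rewrite integral_cst//= probability_setT mule1 -EFinD subrr adde0.
rewrite rE.
apply: (@le_trans _ _ (m%:E * (C * (m^-1 * r))%:E)%E); first by rewrite lee_wpmul2l// lee_fin.
rewrite -!EFinM lee_fin.
rewrite (_ : m * (C * (m^-1 * r)) = C * r); first by rewrite mulrDl lerDl mul1r.
by field.
Qed.

End lsi.

(** * Comparison of the normalized measure with [exp(- V)] on each side *)

Section weight.
Context {R : realType}.
Local Notation leb := (@lebesgue_measure R).
Variables (w : R -> R) (nw : normalizable w) (V : R -> R) (two : bool) (A : R).
Hypotheses (A_ge0 : 0 <= A) (cV : continuous V).
Hypothesis rho_le : forall (b : bool) (x : R), (b -> two) -> 0 <= x ->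
  expR (- V x) <= A * side b w x.
Hypothesis w_le : forall (b : bool) (x : R), (b -> two) -> 0 <= x ->
  side b w x <= A * expR (- V x).
Hypothesis w_eq0 : forall x : R, ~~ two -> 0 < x -> w (- x) = 0.

Let Z := fine (total_mass w).

Let Z_gt0 : 0 < Z.
Proof.
by apply: fine_gt0; rewrite (normalizable_gt0 nw) (normalizable_lty nw).
Qed.

Let w_ge0 x : 0 <= w x. Proof. exact: normalizable_ge0 nw x. Qed.

Let mw : measurable_fun [set: R] w. Proof. exact: normalizable_meas nw. Qed.

Let mopp : measurable_fun [set: R] (fun x : R => - x).
Proof.
by apply: continuous_measurable_fun; exact: continuous_oppf (@continuous_idf R).
Qed.

Lemma meas_ge0_side (b : bool) (phi : R -> R) : meas_ge0 phi -> meas_ge0 (side b phi).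
Proof.
case: b => -[mphi phi0]; split => // [|x]; last exact: phi0.
exact: measurableT_comp mphi mopp.
Qed.

(** The negative part is reflected. Its half-line stays open at [0], because [w_eq0] says nothing
    about [w 0]. *)
Lemma integral_two_sides (g : R -> R) : meas_ge0 g ->
  (\int[leb]_x (g x)%:E = \int[leb]_(x in `[0%R, +oo[) (g x)%:E
    + \int[leb]_(x in `]0%R, +oo[) (g (- x))%:E)%E.
Proof.
move=> [mg g0].
have mE (D : set R) : measurable_fun D (EFin \o g).
  by apply/measurable_EFinP; exact: measurable_funTS.
have mgo (D : set R) : measurable_fun D (EFin \o (fun x => g (- x))).
  apply/measurable_EFinP; apply: measurable_funTS.
  exact: measurableT_comp mg mopp.
rewrite -(setUv `[0%R, +oo[%classic) ge0_integral_setU//=; last 4 first.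
- exact: measurableC.
- exact: mE.
- by move=> x _; rewrite lee_fin.
- exact/disj_setPCl.
congr (_ + _)%E.
rewrite setCitvr integral_itv_bndo_bndc; last exact: mE.
rewrite integral_itv_obnd_cbnd; last exact: mgo.
rewrite ge0_integration_by_substitution0//; last by move=> x; rewrite lee_fin.
by apply: eq_integral => x _ /=; rewrite opprK.
Qed.

Lemma halfint_le_normalized (phi : R -> R) (r : R) (b : bool) :
  meas_ge0 phi -> (b -> two) -> (\int[normalized nw]_x (phi x)%:E <= r%:E)%E ->
  (halfint V (side b phi) <= (A * Z * r)%:E)%E.
Proof.
move=> mphi bt hr; have [mp p0] := mphi.
have [msp sp0] := meas_ge0_side b mphi.
have msw : meas_ge0 (side b w) by exact: meas_ge0_side.
have mg : meas_ge0 (fun x => phi x * (w x / Z)).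
  split; first by apply: measurable_funM => //; exact: measurable_funM.
  by move=> x; rewrite mulr_ge0// divr_ge0// ltW.
have [msg sg0] := meas_ge0_side b mg.
rewrite EFinM; apply: (@le_trans _ _ ((A * Z)%:E *
    \int[leb]_(x in `[0%R, +oo[) (side b (fun x => phi x * (w x / Z)) x)%:E)%E).
  rewrite -ge0_integralZl_EFin ?mulr_ge0 ?(ltW Z_gt0)//; last 2 first.
  - by move=> x _; rewrite lee_fin.
  - by apply/measurable_EFinP; exact: measurable_funTS.
  apply: ge0_le_integral => //.
  - by move=> x _; rewrite lee_fin mulr_ge0// expR_ge0.
  - apply/measurable_EFinP; apply: measurable_funTS; apply: measurable_funM => //.
    apply: measurableT_comp => //; apply: continuous_measurable_fun.
    exact: continuous_oppf.
  - apply: measurable_funeM.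
    by apply/measurable_EFinP; exact: measurable_funTS.
  - move=> x /=; rewrite in_itv/= andbT => x0; rewrite -EFinM lee_fin.
    have := ler_wpM2l (sp0 x) (rho_le bt x0).
    rewrite /side => /le_trans; apply; rewrite le_eqVlt; apply/orP; left.
    by apply/eqP; field; rewrite gt_eqF.
apply: lee_wpmul2l; first by rewrite lee_fin mulr_ge0// ltW.
(* Only the side [b] of the splitting is kept; the other is nonnegative, and the endpoint [0] is
   negligible. *)
apply: le_trans hr; rewrite integral_normalized// -/Z (integral_two_sides mg).
rewrite /side; case: b {msp sp0 msw msg sg0} bt => bt.
  rewrite -integral_itv_obnd_cbnd; last first.
    apply/measurable_EFinP; apply: measurable_funTS.
    by have [] := meas_ge0_side true mg.
  rewrite leeDr//; apply: integral_ge0 => x _; rewrite lee_fin; exact: (mg.2 x).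
by rewrite leeDl//; apply: integral_ge0 => x _; rewrite lee_fin; exact: (mg.2 (- x)).
Qed.

(** The factor [2] counts the two sides; when [two] is false the negative side has no mass. *)
Lemma normalized_le_halfint (phi : R -> R) (r : R) : meas_ge0 phi -> 0 <= r ->
  (forall b : bool, (b -> two) -> (halfint V (side b phi) <= r%:E)%E) ->
  (\int[normalized nw]_x (phi x)%:E <= (2 * (A / Z) * r)%:E)%E.
Proof.
move=> mphi r0 hr; have [mp p0] := mphi.
have AZ : 0 <= A / Z by rewrite divr_ge0// ltW.
have mg : meas_ge0 (fun x => phi x * (w x / Z)).
  split; first by apply: measurable_funM => //; exact: measurable_funM.
  by move=> x; rewrite mulr_ge0// divr_ge0// ltW.
rewrite integral_normalized// -/Z (integral_two_sides mg).
have half (b : bool) : (b -> two) ->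
    (\int[leb]_(x in `[0%R, +oo[) (side b (fun x => phi x * (w x / Z)) x)%:E
      <= (A / Z * r)%:E)%E.
  move=> bt; have [msp sp0] := meas_ge0_side b mphi.
  have [msg sg0] := meas_ge0_side b mg.
  have mre : measurable_fun [set: R] (fun x => side b phi x * expR (- V x)).
    apply: measurable_funM => //; apply: measurableT_comp => //.
    by apply: continuous_measurable_fun; exact: continuous_oppf.
  apply: (@le_trans _ _ ((A / Z)%:E * halfint V (side b phi))%E); last first.
    by rewrite [leRHS]EFinM lee_wpmul2l// hr.
  rewrite /halfint -ge0_integralZl_EFin//; last 2 first.
  - by move=> x _; rewrite lee_fin mulr_ge0// expR_ge0.
  - by apply/measurable_EFinP; exact: measurable_funTS.
  apply: ge0_le_integral => //.
  - by move=> x _; rewrite lee_fin.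
  - by apply/measurable_EFinP; exact: measurable_funTS.
  - apply: measurable_funeM.
    by apply/measurable_EFinP; exact: measurable_funTS.
  - move=> x /=; rewrite in_itv/= andbT => x0; rewrite -EFinM lee_fin.
    have Zi : 0 <= side b phi x / Z by rewrite divr_ge0// ltW.
    have := ler_wpM2l Zi (w_le bt x0); rewrite /side => h.
    have -> : forall u v : R, u * (v / Z) = u / Z * v by move=> u v; ring.
    apply: (le_trans h); rewrite le_eqVlt; apply/orP; left.
    by apply/eqP; ring.
have -> : 2 * (A / Z) * r = A / Z * r + A / Z * r by ring.
rewrite EFinD; apply: leeD; first exact: (half false).
case: (boolP two) => htwo.
  rewrite integral_itv_obnd_cbnd; first exact: (half true).
  apply/measurable_EFinP; apply: measurable_funTS.
  by have [] := meas_ge0_side true mg.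
rewrite (_ : (\int[leb]_(x in `]0%R, +oo[) _ = 0)%E); first by rewrite lee_fin mulr_ge0.
rewrite -(integral0 leb `]0%R, +oo[%classic); apply: eq_integral => x.
by rewrite inE/= in_itv/= andbT => x0; rewrite w_eq0// mul0r mulr0.
Qed.

End weight.

(** * The measures tau and gamma *)

Section lsi_weight.
Context {R : realType}.
Variables (w : R -> R) (nw : normalizable w) (V dV : R -> R) (two : bool).
Variables (p beta c M K A : R).
Hypotheses (p_gt0 : 0 < p) (beta_ge2 : 2 <= beta) (pbeta : p * (beta - 1) = 1).
Hypotheses (c_gt0 : 0 < c) (M_ge0 : 0 <= M) (K_ge0 : 0 <= K) (A_ge0 : 0 <= A).
Hypotheses (cV : continuous V) (cdV : continuous dV).
Hypothesis V_derive : forall x : R, 0 < x -> is_derive x 1 V (dV x).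
Hypothesis dV_ge : forall x : R, 0 <= x -> c * `|x| `^ p - M <= dV x.
Hypothesis dV_le : forall x : R,
  0 <= x -> `|dV x| <= K * (1 + `|x| * `|x| `^ p).
Hypothesis V_le : forall x : R, 0 <= x -> V x <= K * (1 + `|x| * `|x| `^ p).
Hypothesis rho_le : forall (b : bool) (x : R), (b -> two) -> 0 <= x ->
  expR (- V x) <= A * side b w x.
Hypothesis w_le : forall (b : bool) (x : R), (b -> two) -> 0 <= x ->
  side b w x <= A * expR (- V x).
Hypothesis w_eq0 : forall x : R, ~~ two -> 0 < x -> w (- x) = 0.

Lemma LSI_weight : exists C : R, LSI (normalized nw) 1 beta C.
Proof.
(* The truncation index [m] is the integer part of [beta], so that [q = 2 (m + 1)] is even and at
   least [beta]. *)
have beta_le : beta <= (Num.truncn beta).+1.*2%:R.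
  have /andP[_ h] := Num.Theory.truncn_itv (le_trans (ler0n R 2) beta_ge2).
  by rewrite (le_trans (ltW h))// ler_nat -addnn leq_addr.
have Z_gt0 : 0 < fine (total_mass w).
  by apply: fine_gt0; rewrite (normalizable_gt0 nw) (normalizable_lty nw).
have k1 : 0 <= A * fine (total_mass w) by rewrite mulr_ge0// ltW.
have k2 : 0 <= 2 * (A / fine (total_mass w)) by rewrite mulr_ge0// divr_ge0// ltW.
have [C C0 HC] := ent_le_energy beta_ge2 k1 k2
  (fun phi r b => @halfint_le_normalized R w nw V two A A_ge0 cV rho_le phi r b)
  (fun phi r => @normalized_le_halfint R w nw V two A A_ge0 cV w_le w_eq0 phi r)
  (halfint_poincare p_gt0 beta_ge2 pbeta c_gt0 M_ge0 cV cdV V_derive dV_ge)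
  (halfint_entropy p_gt0 beta_ge2 pbeta beta_le c_gt0 M_ge0 K_ge0 cV cdV V_derive
    dV_ge dV_le V_le).
by exists (C + 1); exact: LSI_of_ent_le_energy.
Qed.

End lsi_weight.

(** * Inequalities and derivatives for real powers *)

Section powers.
Context {R : realType}.
Implicit Types (x p r : R).

Lemma powR_le1D p x : 0 < p -> 0 <= x -> x `^ p <= 1 + x * x `^ p.
Proof.
move=> p0 x0; have [x1|/ltW x1] := leP x 1.
  apply: (@le_trans _ _ 1); last by rewrite lerDl mulr_ge0 ?powR_ge0.
  rewrite -[leRHS](congr1 (fun f => f p) (@powR1 R)).
  by apply: ge0_ler_powR; rewrite ?nnegrE// ltW.
by apply: (@le_trans _ _ (x * x `^ p)); [rewrite ler_peMl ?powR_ge0|rewrite lerDr].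
Qed.

Lemma le_1DpowR p x : 0 < p -> 0 <= x -> x <= 1 + x * x `^ p.
Proof.
move=> p0 x0; have [x1|/ltW x1] := leP x 1.
  by apply: (le_trans x1); rewrite lerDl mulr_ge0 ?powR_ge0.
apply: (@le_trans _ _ (x * x `^ p)); last by rewrite lerDr.
rewrite ler_peMr// -[leLHS](congr1 (fun f => f p) (@powR1 R)).
by apply: ge0_ler_powR; rewrite ?nnegrE// ltW.
Qed.

(** Write [(1 + x)^p] as [(1 + x)^(p-1) + x (1 + x)^(p-1)]; since [p - 1 <= 0], the first term is at
    most [1] and the second at most [x x^(p-1)]. *)
Lemma powR_1D_le p x : 0 < p <= 1 -> 0 <= x -> (1 + x) `^ p <= 1 + x `^ p.
Proof.
move=> /andP[p0 p1]; rewrite le_eqVlt => /predU1P[<-|x0].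
  by rewrite addr0 powR1 powR0 ?gt_eqF// addr0.
rewrite -(@mulr_powRB1 _ (1 + x))//; last by rewrite addr_ge0// ltW.
rewrite mulrDl mul1r lerD//.
  by rewrite -[leRHS](powRr0 (1 + x)) ler_powR ?subr_le0// lerDl ltW.
rewrite -[leRHS](mulr_powRB1 (ltW x0) p0); apply: ler_wpM2l; first exact: ltW.
rewrite -(opprB 1) !powRN lef_pV2 ?posrE ?powR_gt0 ?addr_gt0//.
by apply: ge0_ler_powR; rewrite ?nnegrE ?subr_ge0 ?addr_ge0 ?(ltW x0)// lerDr.
Qed.

Lemma powR_1D_ge p x : 0 < p -> 0 <= x -> x `^ p <= (1 + x) `^ p.
Proof.
by move=> p0 x0; apply: ge0_ler_powR; rewrite ?nnegrE ?addr_ge0 ?lerDr// ltW.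
Qed.

Lemma continuous_1Dnorm_powR r : continuous (fun x => (1 + `|x|) `^ r).
Proof.
move=> x; apply: (@continuous_comp _ _ _ (fun x : R => 1 + `|x|) (fun y : R => y `^ r)).
  apply: continuous_addf; first exact: continuous_cstf.
  exact: norm_continuous.
apply: differentiable_continuous; apply/derivable1_diffP.
by apply: derivable_powR; rewrite in_itv/= andbT ltr_pwDl.
Qed.

Lemma is_derive_1Dnorm_powR r x : 0 < x ->
  is_derive x 1 (fun y : R => (1 + `|y|) `^ r) (r * (1 + `|x|) `^ (r - 1)).
Proof.
move=> x0; have h := is_derive_addf (is_derive_cstf 1 x) (is_derive1_norm x0).
have x1 : 0 < 1 + `|x| by rewrite ltr_pwDl.
have := is_derive_compf h (is_derive1_powR r x1).
by move=> /is_derive_eq; apply; rewrite add0r mulr1.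
Qed.

Lemma is_derive_normM_powR p x : 0 < p -> 0 < x ->
  is_derive x 1 (fun y : R => `|y| * `|y| `^ p) ((p + 1) * `|x| `^ p).
Proof.
move=> p0 x0; have x1 : 0 < `|x| by rewrite normr_gt0 gt_eqF.
have hx := is_derive1_norm x0.
have := is_derive_mulf hx (is_derive_compf hx (is_derive1_powR p x1)).
move=> /is_derive_eq; apply.
rewrite mul1r mulr1 mulrCA mulr_powRB1//; ring.
Qed.

End powers.

(** * The potentials of the two measures *)

Section tau_gamma.
Context {R : realType}.
Variables (alpha b beta : R).
Hypotheses (halpha : 1 < alpha <= 2) (hbeta : 2 <= beta).
Hypothesis hconj : alpha^-1 + beta^-1 = 1.

Let p := alpha - 1.

Let p_gt0 : 0 < p. Proof. by case/andP: halpha => a1 _; rewrite subr_gt0. Qed.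

Let p_le1 : p <= 1.
Proof. by case/andP: halpha => _ a2; rewrite /p; lra. Qed.

Let pbeta : p * (beta - 1) = 1.
Proof.
have a0 : alpha != 0 by case/andP: halpha => a1 _; rewrite gt_eqF// (lt_trans _ a1).
have b0 : beta != 0 by rewrite gt_eqF// (lt_le_trans _ hbeta).
have h : alpha * beta * (alpha^-1 + beta^-1) = alpha * beta * 1 by rewrite hconj.
have h' : beta + alpha = alpha * beta.
  by rewrite -[RHS]mulr1 -h; field; rewrite a0 b0.
by rewrite /p; lra.
Qed.

Let alphaE (x : R) : 0 <= x -> x `^ alpha = x * x `^ p.
Proof.
move=> x0; rewrite mulr_powRB1//.
by case/andP: halpha => a1 _; exact: lt_trans a1.
Qed.

Let continuous_normM_powR : continuous (fun x : R => `|x| * `|x| `^ p).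
Proof.
apply: continuous_mulf; last exact: continuous_normr_powR.
exact: norm_continuous.
Qed.

Lemma LSI_gamma : exists C : R, LSI (gamma b halpha) 1 beta C.
Proof.
(* On [x >= 0] the weight is exactly [exp(- V)], so the comparison constant is [1]; absolute values
   make [V] continuous on the whole line. *)
pose V (x : R) := `|x| * `|x| `^ p + - (b * ln (1 + `|x|)).
pose dV (x : R) := (p + 1) * `|x| `^ p + - (b * (1 + `|x|)^-1).
have n1 (x : R) : 0 < 1 + `|x| by rewrite ltr_pwDl.
have cn : continuous (fun x : R => 1 + `|x|).
  apply: continuous_addf; first exact: continuous_cstf.
  exact: norm_continuous.
have bi (x : R) : `|b * (1 + `|x|)^-1| <= `|b|.
  rewrite normrM ler_piMr// normfV (gtr0_norm (n1 x)) invf_le1//.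
  by rewrite lerDl.
pose K := p + 1 + `|b|.
have K0 : 0 <= K by rewrite addr_ge0// addr_ge0// ltW.
have XE (x : R) : 0 <= x -> `|x| = x by exact: ger0_norm.
have wE (x : R) : 0 <= x -> gamma_weight alpha b x = expR (- V x).
  move=> x0; rewrite /gamma_weight indicE mem_set/= ?in_itv/= ?x0// mulr1.
  rewrite /V XE// opprD opprK expRD -alphaE// mulrC [(1 + x) `^ b]/powR gt_eqF//.
  by have := n1 x; rewrite XE.
(* The measure is one-sided, hence [false]; [M] is [|b|] because the logarithmic term has derivative
   at most [|b|] in modulus. *)
apply: (@LSI_weight R _ (gamma_normalizable b halpha) V dV false p beta
  (p + 1) `|b| K 1).
- exact: p_gt0.
- exact: hbeta.
- exact: pbeta.
- by rewrite addr_gt0.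
- exact: normr_ge0.
- exact: K0.
- exact: ler01.
- apply: continuous_addf => //; apply: continuous_oppf.
  apply: continuous_mulf; first exact: continuous_cstf.
  by move=> x; apply: continuous_comp; [exact: cn|exact: continuous_ln].
- apply: continuous_addf.
    apply: continuous_mulf; first exact: continuous_cstf.
    exact: continuous_normr_powR.
  apply: continuous_oppf; apply: continuous_mulf; first exact: continuous_cstf.
  move=> x; apply: (@continuous_comp _ _ _ (fun x : R => 1 + `|x|)
    (fun y : R => y^-1)); first exact: cn.
  by apply: inv_continuous; rewrite gt_eqF.
- move=> x x0; apply: is_derive_addf; first exact: is_derive_normM_powR.
  have hx := is_derive_addf (is_derive_cstf 1 x) (is_derive1_norm x0).
  have hl := is_derive_compf hx (is_derive1_ln (n1 x)).
  have := is_derive_oppf (is_derive_mulf (is_derive_cstf b x) hl).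
  by move=> /is_derive_eq; apply; rewrite mul0r add0r add0r mulr1.
- move=> x x0; rewrite /dV lerD2l lerN2.
  exact: le_trans (ler_norm _) (bi x).
- move=> x x0; rewrite /dV.
  apply: (le_trans (ler_normD _ _)); rewrite normrN.
  have h1 := bi x.
  have h2 : `|(p + 1) * `|x| `^ p| = (p + 1) * `|x| `^ p.
    by rewrite ger0_norm// mulr_ge0 ?powR_ge0// addr_ge0// ltW.
  have h3 := powR_le1D p_gt0 (normr_ge0 x).
  have p1 : 0 <= p + 1 by rewrite addr_ge0// ltW.
  have h4 := ler_wpM2l p1 h3.
  have h5 : 0 <= `|b| * (`|x| * `|x| `^ p) by rewrite !mulr_ge0 ?powR_ge0.
  by rewrite h2 /K; lra.
- move=> x x0; rewrite /V XE//.
  have h1 : - (b * ln (1 + x)) <= `|b| * x.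
    apply: (le_trans (ler_norm _)); rewrite normrN normrM ler_wpM2l//.
    rewrite ger0_norm; first by apply: le_ln1Dx; lra.
    by rewrite ln_ge0// lerDl.
  have h2 := ler_wpM2l (normr_ge0 b) (le_1DpowR p_gt0 x0).
  have h3 : 0 <= x * x `^ p by rewrite mulr_ge0 ?powR_ge0.
  have h4 : 0 <= p * (1 + x * x `^ p).
    by apply: mulr_ge0; [exact: ltW|exact: addr_ge0].
  by rewrite /K; lra.
- by move=> [] x bt x0; [have := bt isT|rewrite /side wE// mul1r].
- by move=> [] x bt x0; [have := bt isT|rewrite /side wE// mul1r].
- move=> x _ x0; rewrite /gamma_weight indicE memNset/= ?mulr0//.
  by rewrite in_itv/= andbT; apply/negP; rewrite -ltNge oppr_lt0.
Qed.

(* [|x|^p cos x] is replaced by [(1 + |x|)^p cos x], which is differentiable up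
   to [0]; they differ by at most [1]. *)
Lemma LSI_tau : exists C : R, LSI (tau halpha) 1 beta C.
Proof.
pose V (x : R) := `|x| * `|x| `^ p + (1 + `|x|) `^ p * cos x.
pose dV (x : R) := (p + 1) * `|x| `^ p +
  (p * (1 + `|x|) `^ (p - 1) * cos x + (1 + `|x|) `^ p * - sin x).
pose K := 2 * p + 3.
have K0 : 0 <= K by rewrite addr_ge0// mulr_ge0// ltW.
have XE (x : R) : 0 <= x -> `|x| = x by exact: ger0_norm.
have p01 : 0 < p <= 1 by rewrite p_gt0 p_le1.
have q1 (x : R) : 0 <= (1 + `|x|) `^ (p - 1) <= 1.
  rewrite powR_ge0/= -[leRHS](powRr0 (1 + `|x|)) ler_powR ?subr_le0//.
  by rewrite lerDl.
have diff (x : R) : `|V x - (`|x| `^ alpha + `|x| `^ (alpha - 1) * cos x)| <= 1.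
  rewrite alphaE// /V -/p.
  rewrite (_ : _ - _ = ((1 + `|x|) `^ p - `|x| `^ p) * cos x); last by ring.
  have h1 := powR_1D_le p01 (normr_ge0 x).
  have h2 := powR_1D_ge p_gt0 (normr_ge0 x).
  rewrite normrM -[leRHS]mulr1 ler_pM//.
    by rewrite ger0_norm ?subr_ge0//; lra.
  by rewrite ler_norml cos_geN1 cos_le1.
have sideE bb x : side bb (tau_weight alpha) x = tau_weight alpha x.
  by rewrite /side; case: bb => //; rewrite /tau_weight normrN cosN.
(* In [dV] the sine term can cost [(1 + x)^p <= 1 + x^p] and the cosine term [p], so [(p + 1) x^p]
   drops to [p x^p - (p + 1)]. The potentials differ by at most [1], whence [expR 1]. *)
apply: (@LSI_weight R _ (tau_normalizable halpha) V dV true p beta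
  p (p + 1) K (expR 1)).
- exact: p_gt0.
- exact: hbeta.
- exact: pbeta.
- exact: p_gt0.
- by rewrite addr_ge0// ltW.
- exact: K0.
- exact: expR_ge0.
- apply: continuous_addf => //; apply: continuous_mulf; last exact: continuous_cos.
  exact: continuous_1Dnorm_powR.
- apply: continuous_addf.
    apply: continuous_mulf; first exact: continuous_cstf.
    exact: continuous_normr_powR.
  apply: continuous_addf.
    apply: continuous_mulf; last exact: continuous_cos.
    apply: continuous_mulf; first exact: continuous_cstf.
    exact: continuous_1Dnorm_powR.
  apply: continuous_mulf; first exact: continuous_1Dnorm_powR.
  by apply: continuous_oppf; exact: continuous_sin.
- move=> x x0; apply: is_derive_addf; first exact: is_derive_normM_powR.
  exact: is_derive_mulf (is_derive_1Dnorm_powR p x0) (is_derive_cos x).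
- move=> x x0; rewrite /dV.
  have h1 := powR_1D_le p01 (normr_ge0 x).
  have h0 := powR_ge0 (1 + `|x|) p.
  have h2 : - p <= p * (1 + `|x|) `^ (p - 1) * cos x.
    have /andP[a0 a1] := q1 x.
    have c1 : - 1 <= (1 + `|x|) `^ (p - 1) * cos x.
      apply: (@le_trans _ _ ((1 + `|x|) `^ (p - 1) * -1)); first lra.
      by rewrite ler_wpM2l// cos_geN1.
    have := ler_wpM2l (ltW p_gt0) c1; lra.
  have h3 : - (1 + `|x|) `^ p <= (1 + `|x|) `^ p * - sin x.
    by rewrite mulrN lerN2 ler_piMr// sin_le1.
  by lra.
- move=> x x0; rewrite /dV.
  have h0 := powR_ge0 (1 + `|x|) p.
  have h1 := powR_1D_le p01 (normr_ge0 x).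
  have h2 : `|p * (1 + `|x|) `^ (p - 1) * cos x| <= p.
    have /andP[a0 a1] := q1 x.
    rewrite !normrM (gtr0_norm p_gt0) (ger0_norm a0) -mulrA ler_piMr ?(ltW p_gt0)//.
    by rewrite mulr_ile1// ler_norml cos_geN1 cos_le1.
  have h3 : `|(1 + `|x|) `^ p * - sin x| <= (1 + `|x|) `^ p.
    by rewrite normrM normrN (ger0_norm h0) ler_piMr// ler_norml sin_geN1 sin_le1.
  have h4 : `|(p + 1) * `|x| `^ p| = (p + 1) * `|x| `^ p.
    by rewrite ger0_norm// mulr_ge0 ?powR_ge0// addr_ge0// ltW.
  have h5 := powR_le1D p_gt0 (normr_ge0 x).
  have p2 : 0 <= p + 2 by rewrite addr_ge0// ltW.
  have h6 := ler_wpM2l p2 h5.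
  have h7 : 0 <= `|x| * `|x| `^ p by rewrite mulr_ge0 ?powR_ge0.
  have h8 : 0 <= p * (`|x| * `|x| `^ p) by rewrite mulr_ge0// ltW.
  have h9 := ler_normD ((p + 1) * `|x| `^ p)
    (p * (1 + `|x|) `^ (p - 1) * cos x + (1 + `|x|) `^ p * - sin x).
  have h10 := ler_normD (p * (1 + `|x|) `^ (p - 1) * cos x)
    ((1 + `|x|) `^ p * - sin x).
  by rewrite /K; lra.
- move=> x x0; rewrite /V.
  have h1 := powR_1D_le p01 (normr_ge0 x).
  have h2 : (1 + `|x|) `^ p * cos x <= (1 + `|x|) `^ p.
    by rewrite ler_piMr ?powR_ge0// cos_le1.
  have h5 := powR_le1D p_gt0 (normr_ge0 x).
  have h7 : 0 <= `|x| * `|x| `^ p by rewrite mulr_ge0 ?powR_ge0.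
  have h8 : 0 <= p * (1 + `|x| * `|x| `^ p) by apply: mulr_ge0; [exact: ltW|exact: addr_ge0].
  by rewrite /K; lra.
- move=> bb x _ x0; rewrite sideE /tau_weight -expRD ler_expR.
  by have := diff x; rewrite ler_norml; lra.
- move=> bb x _ x0; rewrite sideE /tau_weight -expRD ler_expR.
  by have := diff x; rewrite ler_norml; lra.
- by [].
Qed.

End tau_gamma.

Theorem proposition4p3 (R : realType) (alpha b beta : R)
    (halpha : 1 < alpha <= 2) (hbeta : 2 <= beta)
    (hconj : alpha^-1 + beta^-1 = 1) :
  exists2 a : R, 0 < a &
    (exists C : R, LSI (tau halpha) a beta C) /\
    (exists C : R, LSI (gamma b halpha) a beta C).
Proof. by exists 1 => //; split; [exact: LSI_tau|exact: LSI_gamma]. Qed.
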